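(* Let $\mathfrak{c}$ be a big chamber for $\Phi$ and $\mathbf{y}$ a generic element of $\mathbb{C}^N$. Let $E[\mathfrak{c},\mathbf{y},\Phi](\lambda)$ be the function of $\lambda$ defined by $$E[\mathfrak{c},\mathbf{y},\Phi](\lambda)=\sum_{\sigma\in\mathcal{B}(\Phi,\mathfrak{c})}\frac{1}{\mathrm{vol}_{\Gamma^*}(\sigma)}\sum_{p\in RG(\sigma,\mathbf{y},\Gamma)}e^{-\langle\lambda,p\rangle}\prod_{\beta_k\notin\sigma}\frac{1}{1-e^{y_k}e^{\langle\beta_k,p\rangle}}.$$ Then, for $\lambda\in(\mathfrak{c}-\Box(\Phi))\cap\Gamma^*$, $$\mathcal{S}[e^{\mathbf{y}},\Phi](\lambda)=E[\mathfrak{c},\mathbf{y},\Phi](\lambda).$$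
   Context: $V$ is a real vector space of dimension $n$ with a rank-$n$ lattice $\Gamma$, $\Gamma^*\subset V^*$ is the dual lattice, $V_{\mathbb{C}}=V\otimes\mathbb{C}$. $\Phi=[\beta_1,\dots,\beta_N]$ is a sequence of not necessarily distinct elements of $\Gamma^*$, spanning $V^*$ and lying in an open halfspace of $V^*$. $\mathcal{B}(\Phi)$ is the set of linearly independent $n$-tuples $\sigma$ of elements of the sequence $\Phi$ (such $\sigma$ is identified with the corresponding $n$-element set of indices, so that ''$\beta_k\notin\sigma$'' refers to indices $k$ not belonging to $\sigma$); $C(\nu)$ is the closed cone generated by $\nu$. Big chambers: the connected components of the complement in $V^*$ of the union of the cones $C(\nu)$, $\nu\subset\Phi$ of cardinality $<n$. For a big chamber $\mathfrak{c}$, $\mathcal{B}(\Phi,\mathfrak{c})=\{\sigma\in\mathcal{B}(\Phi) : \mathfrak{c}\subset C(\sigma)\}$. $\Box(\Phi)=\sum_{i=1}^N[0,1]\beta_i$ and $\mathfrak{c}-\Box(\Phi)=\{x-y : x\in\mathfrak{c},\,y\in\Box(\Phi)\}$. $\Pi_\Phi(\lambda)=\{\mathbf{x}\in\mathbb{R}_{\ge0}^N : \sum_kx_k\beta_k=\lambda\}$, and for $\mathbf{y}=(y_1,\dots,y_N)\in\mathbb{C}^N$, $\mathcal{S}[e^{\mathbf{y}},\Phi](\lambda)=\sum_{\xi\in\Pi_\Phi(\lambda)\cap\mathbb{Z}^N}e^{\langle\mathbf{y},\xi\rangle}$, with $\langle\mathbf{y},\xi\rangle=\sum_iy_i\xi_i$.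 For $\sigma\in\mathcal{B}(\Phi)$, $G(\sigma,\mathbf{y},\Gamma)=\{p\in V_{\mathbb{C}} : e^{\langle\beta_j,p\rangle}=e^{-y_j}\text{ for all }\beta_j\in\sigma\}$, which is invariant under translation by $2\pi i\Gamma$; $RG(\sigma,\mathbf{y},\Gamma)$ is a (finite) set of representatives of $G(\sigma,\mathbf{y},\Gamma)$ modulo $2\pi i\Gamma$. $\mathbf{y}$ is generic if for every $\sigma\in\mathcal{B}(\Phi)$, every $p\in G(\sigma,\mathbf{y},\Gamma)$ and every $\beta_k\notin\sigma$ one has $e^{y_k}e^{\langle\beta_k,p\rangle}\ne1$ (in particular the sets $G(\sigma,\mathbf{y},\Gamma)$, $\sigma\in\mathcal{B}(\Phi)$, are then pairwise disjoint). $\mathrm{vol}_{\Gamma^*}$ is the measure on $V^*$ for which a minimal parallelepiped spanned by elements of $\Gamma^*$ has volume $1$, and $\mathrm{vol}_{\Gamma^*}(\sigma)$ is the volume of $\sum_{\beta\in\sigma}[0,1]\beta$. *)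

(* Defs.v *)
From HB Require Import structures.
From mathcomp Require Import all_boot all_order all_algebra.
From mathcomp Require Import complex.
From mathcomp Require Import all_classical all_reals all_analysis.

Set Implicit Arguments.
Unset Strict Implicit.
Unset Printing Implicit Defensive.

Import Order.TTheory GRing.Theory Num.Theory.
Import numFieldNormedType.Exports.

Local Open Scope classical_set_scope.
Local Open Scope complex_scope.
Local Open Scope ring_scope.

(* V is 'cV[R]_n, its dual V^* is 'rV[R]_n, V_C is 'cV[R[i]]_n, and the pairing
   of a linear form with a vector is the matrix product. *)

Definition cexp (R : realType) (z : R[i]) : R[i] :=
  (expR (complex.Re z) * cos (complex.Im z))
    +i* (expR (complex.Re z) * sin (complex.Im z)).

Definition pairing (R : realType) (n : nat) (l : 'rV[R]_n) (v : 'cV[R]_n) : R :=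
  (l *m v) 0 0.

Definition cpairing (R : realType) (n : nat)
    (l : 'rV[R]_n) (p : 'cV[R[i]]_n) : R[i] :=
  (map_mx (real_complex R) l *m p) 0 0.

Section Lattices.
Variable R : realType.

Definition is_Zbasis (W : vectType R) (n : nat) (L : set W) (b : n.-tuple W) :=
  basis_of fullv b /\
  L = [set \sum_(i < n) tnth b i *~ z i | z in [set: 'I_n -> int]].

Definition is_full_lattice (n : nat) (Gamma : set 'cV[R]_n) :=
  exists b : n.-tuple 'cV[R]_n, is_Zbasis Gamma b.

Definition dual_lattice (n : nat) (Gamma : set 'cV[R]_n) : set 'rV[R]_n :=
  [set l | forall v, Gamma v -> pairing l v \is a Num.int].

End Lattices.

Section Configurations.
Variables (R : realType) (n N : nat) (Phi : N.-tuple 'rV[R]_n).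

Definition spans_dual := (<<Phi>>%VS = fullv).

Definition in_open_halfspace :=
  exists v : 'cV[R]_n, forall k : 'I_N, 0 < pairing (tnth Phi k) v.

Definition cone (s : {set 'I_N}) : set 'rV[R]_n :=
  [set \sum_(k in s) t k *: tnth Phi k
    | t in [set t : 'I_N -> R | forall k, 0 <= t k]].

Definition zonotope (s : {set 'I_N}) : set 'rV[R]_n :=
  [set \sum_(k in s) t k *: tnth Phi k
    | t in [set t : 'I_N -> R | forall k, 0 <= t k <= 1]].

Definition box : set 'rV[R]_n := zonotope [set: 'I_N]%SET.

Definition bases : set {set 'I_N} :=
  [set s : {set 'I_N} | #|s| = n /\ free [seq tnth Phi k | k <- enum s]].

Definition regular_set : set 'rV[R]_n :=
  ~` \bigcup_(nu in [set nu : {set 'I_N} | (#|nu| < n)%N]) cone nu.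

Definition big_chamber (c : set 'rV[R]_n) :=
  exists2 x, regular_set x & c = connected_component regular_set x.

Definition chamber_bases (c : set 'rV[R]_n) : set {set 'I_N} :=
  [set s | bases s /\ c `<=` cone s].

Definition partition_polytope (l : 'rV[R]_n) : set 'rV[R]_N :=
  [set x | (forall k, 0 <= x 0 k) /\ \sum_(k < N) x 0 k *: tnth Phi k = l].

Definition integral_points : set 'rV[R]_N :=
  [set x | forall k, x 0 k \is a Num.int].

(* \sum_(_ \in _) is a finite-support sum; the index set here is finite as soon
   as Phi lies in an open halfspace. *)
Definition partition_sum (y : 'rV[R[i]]_N) (l : 'rV[R]_n) : R[i] :=
  \sum_(xi \in partition_polytope l `&` integral_points)
    cexp (\sum_(k < N) y 0 k * (xi 0 k)%:C).

Definition Gset (y : 'rV[R[i]]_N) (s : {set 'I_N}) : set 'cV[R[i]]_n :=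
  [set p | forall j, j \in s -> cexp (cpairing (tnth Phi j) p) = cexp (- y 0 j)].

Definition generic (y : 'rV[R[i]]_N) :=
  forall s, bases s -> forall p, Gset y s p -> forall k, k \notin s ->
    cexp (y 0 k) * cexp (cpairing (tnth Phi k) p) != 1.

End Configurations.

Section Representatives.
Variables (R : realType) (n : nat).

Definition two_pi_i (Gamma : set 'cV[R]_n) : set 'cV[R[i]]_n :=
  [set map_mx (fun x : R => 0 +i* (2 * pi * x)) v | v in Gamma].

Definition is_representatives (Gamma : set 'cV[R]_n) (G T : set 'cV[R[i]]_n) :=
  T `<=` G /\
  forall p, G p -> exists! q, T q /\ two_pi_i Gamma (p - q).

End Representatives.

Section Volume.
Variables (R : realType) (n : nat).

Definition borel_dual := g_sigma_algebraType (@open 'rV[R]_n).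

(* The translation-invariant Borel measure for which the parallelepiped spanned
   by a Z-basis of L has volume 1; these conditions determine it. *)
Definition is_lattice_volume (L : set 'rV[R]_n)
    (vol : {measure set borel_dual -> \bar R}) :=
  (forall (v : 'rV[R]_n) (A : set 'rV[R]_n),
     <<s @open 'rV[R]_n >> A -> vol [set v + x | x in A] = vol A) /\
  exists b : n.-tuple 'rV[R]_n,
    is_Zbasis L b /\ vol (zonotope b [set: 'I_n]%SET) = 1%E.

End Volume.

Definition Efun (R : realType) (n N : nat) (Phi : N.-tuple 'rV[R]_n)
    (vol : {measure set (borel_dual R n) -> \bar R})
    (y : 'rV[R[i]]_N) (RG : {set 'I_N} -> set 'cV[R[i]]_n)
    (c : set 'rV[R]_n) (l : 'rV[R]_n) : R[i] :=
  \sum_(s \in chamber_bases Phi c)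
    ((fine (vol (zonotope Phi s)))%:C)^-1 *
    \sum_(p \in RG s)
      cexp (- cpairing l p) *
      \prod_(k < N | k \notin s)
        (1 - cexp (y 0 k) * cexp (cpairing (tnth Phi k) p))^-1.

(* Main.v *)
Require Import Defs.
From HB Require Import structures.
From mathcomp Require Import all_boot all_order all_algebra.
From mathcomp Require Import complex.
From mathcomp Require Import all_classical all_reals all_analysis.
From mathcomp Require Import ring lra zify.

(* Fix a regular x in the chamber c. For a set A of indices let S_A and E_A be the
   two sides of the formula for the subfamily A, with c replaced by x: E_A sums
   over the bases s contained in A with x in the cone of s. One shows S_A = E_A
   at the lattice points of x - Box(A) by induction on the size of A.

   For j in A both sides satisfy F_A(l) = F_(A - j)(l) + e^(y_j) F_A(l - beta_j),
   so by induction D = S_A - E_A satisfies D(l) = e^(y_j) D(l - beta_j) for every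
   lattice point l of x - Box(A - j). If x is not in the cone of A both sides are
   zero; otherwise Caratheodory gives a basis s in A with x in its cone.

   If s = A the formula is the orthogonality of the characters of the finite group
   Gamma^* / Z s, whose order is both the number of elements of RG(s) and the
   volume of s.

   If k is in A but not in s, take the smallest relation
   m beta_k = sum_(j in s) a_j beta_j with integral coefficients. Write
   l = x - sum_j t_j beta_j and move the point t of [0, 1]^A along the
   relation. Each time t leaves an integral cube for a neighbouring one, the
   difference equation applies to the corresponding lattice points, so D(l) is
   multiplied by e^(m y_k - sum_j a_j y_j) when t comes back to a translate of
   itself. Genericity prevents this factor from being 1, hence D(l) = 0. *)

Set Implicit Arguments.
Unset Strict Implicit.
Unset Printing Implicit Defensive.

Import Order.TTheory GRing.Theory Num.Theory.
Import numFieldNormedType.Exports.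

Local Open Scope classical_set_scope.
Local Open Scope ring_scope.

(** * The exponential and the pairings *)

Section ComplexExponential.
Variable R : realType.
Implicit Types z w : R[i].

Lemma cexpD z w : cexp (z + w) = cexp z * cexp w.
Proof.
case: z w => [a b] [a' b']; rewrite /cexp/= expRD cosD sinD.
by apply/eqP; rewrite eq_complex /=; apply/andP; split; apply/eqP; ring.
Qed.

Lemma cexp0 : cexp (0 : R[i]) = 1.
Proof. by rewrite /cexp/= expR0 cos0 sin0 mulr1 mulr0. Qed.

Lemma cexp_neq0 z : cexp z != 0.
Proof.
apply/eqP => z0; have := cexpD z (- z).
by rewrite z0 mul0r subrr cexp0 => /eqP; rewrite oner_eq0.
Qed.

Lemma cexpN z : cexp (- z) = (cexp z)^-1.
Proof.
apply: (mulfI (cexp_neq0 z)).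
by rewrite -cexpD subrr cexp0 mulfV// cexp_neq0.
Qed.

Lemma cexpB z w : cexp (z - w) = cexp z / cexp w.
Proof. by rewrite cexpD cexpN. Qed.

Lemma cexp_sum (I : Type) (r : seq I) (P : pred I) (F : I -> R[i]) :
  cexp (\sum_(i <- r | P i) F i) = \prod_(i <- r | P i) cexp (F i).
Proof. by apply: (big_morph (@cexp R)); [exact: cexpD | exact: cexp0]. Qed.

Lemma cexpMn z m : cexp (z *+ m) = cexp z ^+ m.
Proof. by elim: m => [|m IH]; rewrite ?mulr0n ?cexp0 ?expr0// mulrS exprS cexpD IH. Qed.

(** Written with [Complex] so that mapping it over a vector is convertible to the translations that
    form [two_pi_i]. *)
Definition twopii (a : R) : R[i] := Complex 0 (2 * pi * a).

Lemma twopiiD a b : twopii (a + b) = twopii a + twopii b.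
Proof. by apply/eqP; rewrite /twopii eq_complex/= addr0 mulrDr !eqxx. Qed.

Lemma twopiiN a : twopii (- a) = - twopii a.
Proof. by apply/eqP; rewrite /twopii eq_complex/= oppr0 mulrN !eqxx. Qed.

Lemma cexp_twopii_int a : a \is a Num.int -> cexp (twopii a) = 1.
Proof.
have nat_case m : cexp (twopii m%:R) = 1.
  rewrite /cexp/= expR0 !mul1r (_ : 2 * pi * m%:R = 0 + pi *+ 2 *+ m); last first.
    by rewrite add0r !mulr_natr mulr_natl.
  by rewrite (periodicn (@cosD2pi R)) (periodicn (@sinD2pi R)) cos0 sin0.
rewrite intrE => /orP[/natrP[m ->]|/natrP[m am]] //.
by rewrite -[a]opprK am twopiiN cexpN nat_case invr1.
Qed.

(** Reduce [x] modulo 2 pi to [r] in [0, 2 pi[. The half-angle formula gives sin (r / 2) = 0, and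
    the sine is positive on ]0, pi[, so [r] is 0. *)
Lemma cos_eq1_int (x : R) : cos x = 1 -> x / (2 * pi) \is a Num.int.
Proof.
move=> cosx; have pi0 : 0 < 2 * pi :> R by rewrite mulr_gt0 ?pi_gt0.
have /andP := floor_itv (x / (2 * pi)).
set k := Num.floor _ => -[k0 k1]; set r := x - 2 * pi * k%:~R.
have r0 : 0 <= r by rewrite subr_ge0 mulrC -ler_pdivlMr.
have r1 : r < 2 * pi.
  by move: k1; rewrite ltr_pdivrMr// intrD mulrDl mul1r mulrC /r ltrBlDl.
have cosr : cos r = 1.
  have := cexp_twopii_int (intr_int R k); rewrite /cexp/= expR0 !mul1r => /eqP.
  rewrite eq_complex/= => /andP[/eqP ck /eqP sk].
  by rewrite cosB cosx ck sk mulr0 addr0 mulr1.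
have /eqP sr : sin (r / 2) == 0.
  have := cosD (r / 2) (r / 2); rewrite -splitr cosr -!expr2 cos2sin2 => h.
  by rewrite -sqrf_eq0; apply/eqP; lra.
have r00 : r = 0.
  apply/eqP/negPn/negP => rn0; have rgt0 : 0 < r by rewrite lt_neqAle eq_sym rn0.
  have : 0 < r / 2 < pi by apply/andP; split; lra.
  by move=> /sin_gt0_pi; rewrite sr ltxx.
move/eqP: r00; rewrite subr_eq0 => /eqP ->.
by rewrite mulrC mulKf ?intr_int// gt_eqF.
Qed.

(** A vanishing sine makes the cosine 1 or -1; the value -1 would make a real exponential negative,
    so the cosine is 1 and the real part is 0. *)
Lemma cexp_eq1 z : cexp z = 1 -> exists2 a, a \is a Num.int & z = twopii a.
Proof.
case: z => [a b]; rewrite /cexp/= => /eqP; rewrite eq_complex/= => /andP[/eqP c1 /eqP s0].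
have sb : sin b = 0.
  by move/eqP: s0; rewrite mulf_eq0 gt_eqF ?expR_gt0//= => /eqP.
have c2 : cos b ^+ 2 = 1 by rewrite cos2sin2 sb expr0n subr0.
have cb : cos b = 1.
  have := c2; move/eqP; rewrite sqrf_eq1 => /orP[/eqP//|/eqP cb].
  by have := expR_gt0 a; rewrite -[expR a]mulr1 -[1]opprK -cb mulrN c1; lra.
move: c1; rewrite cb mulr1 => ea.
have a0 : a = 0 by apply: expR_inj; rewrite ea expR0.
exists (b / (2 * pi)); first exact: cos_eq1_int.
rewrite a0 /twopii; congr Complex; rewrite mulrC divfK//.
by rewrite lt0r_neq0// mulr_gt0 ?pi_gt0.
Qed.

End ComplexExponential.

Section Pairing.
Variables (R : realType) (n : nat).
Implicit Types (l : 'rV[R]_n) (v : 'cV[R]_n).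

Lemma pairingE l v : pairing l v = \sum_i l 0 i * v i 0.
Proof. by rewrite /pairing mxE. Qed.

Lemma pairingDl l l' v : pairing (l + l') v = pairing l v + pairing l' v.
Proof. by rewrite /pairing mulmxDl mxE. Qed.

Lemma pairingZl a l v : pairing (a *: l) v = a * pairing l v.
Proof. by rewrite /pairing -scalemxAl mxE. Qed.

Lemma pairingNl l v : pairing (- l) v = - pairing l v.
Proof. by rewrite /pairing mulNmx mxE. Qed.

Lemma pairingBl l l' v : pairing (l - l') v = pairing l v - pairing l' v.
Proof. by rewrite pairingDl pairingNl. Qed.

Lemma pairing0l v : pairing 0 v = 0.
Proof. by rewrite /pairing mul0mx mxE. Qed.

Lemma pairing_suml (I : Type) (r : seq I) (P : pred I) (F : I -> 'rV[R]_n) v :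
  pairing (\sum_(i <- r | P i) F i) v = \sum_(i <- r | P i) pairing (F i) v.
Proof. exact: (big_morph ((@pairing R n)^~ v) (fun l l' => pairingDl l l' v) (pairing0l v)). Qed.

Lemma pairingDr l v v' : pairing l (v + v') = pairing l v + pairing l v'.
Proof. by rewrite /pairing mulmxDr mxE. Qed.

Lemma pairingZr a l v : pairing l (a *: v) = a * pairing l v.
Proof. by rewrite /pairing -scalemxAr mxE. Qed.

Lemma pairingNr l v : pairing l (- v) = - pairing l v.
Proof. by rewrite /pairing mulmxN mxE. Qed.

Lemma pairing0r l : pairing l 0 = 0.
Proof. by rewrite /pairing mulmx0 mxE. Qed.

Lemma pairing_sumr (I : Type) (r : seq I) (P : pred I) (F : I -> 'cV[R]_n) l :
  pairing l (\sum_(i <- r | P i) F i) = \sum_(i <- r | P i) pairing l (F i).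
Proof. exact: (big_morph (@pairing R n l) (pairingDr l) (pairing0r l)). Qed.

Lemma pairing_continuous v : continuous ((@pairing R n)^~ v : 'rV[R]_n -> R).
Proof.
rewrite [X in continuous X](_ : _ = fun l => \sum_i l 0 i * v i 0); last first.
  by apply/funext => l; rewrite pairingE.
apply: (@continuous_big R 'I_n +%R 0 xpredT add_continuous) => i _ l.
exact: (cvgM (@coord_continuous R 1 n 0 i l) (cvg_cst (v i 0))).
Qed.

End Pairing.

(** * Dual bases, transversals and integer spans *)

Section DualSystem.
Variables (R : realType) (n N : nat) (Phi : N.-tuple 'rV[R]_n) (s : {set 'I_N}).

(** By the second clause [pairing v (q k)] is the [k]-th coordinate of [v] in the family indexed by
    [s]. Indexing [q] by all of ['I_N] avoids enumerating [s] later. *)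
Definition dual_system (q : 'I_N -> 'cV[R]_n) :=
  (forall j k, j \in s -> k \in s -> pairing (tnth Phi j) (q k) = (j == k)%:R) /\
  (forall v, v = \sum_(k in s) pairing v (q k) *: tnth Phi k).

Lemma bases_dual_system : bases Phi s -> exists q, dual_system q.
Proof.
case=> cs fs.
have es : size (enum s) == n by rewrite -cardE cs.
pose e : n.-tuple 'I_N := Tuple es; pose X := map_tuple (tnth Phi) e.
have Xi (i : 'I_n) : X`_i = tnth Phi (tnth e i) by rewrite -tnth_nth tnth_map.
have fX : free X by [].
have bX : basis_of fullv X by rewrite basisEfree fX subvf /= dimvf /dim /= mul1n size_map (eqP es).
have sume (W : nmodType) (F : 'I_N -> W) : \sum_(k in s) F k = \sum_i F (tnth e i).
  by rewrite -(big_tuple _ _ _ xpredT) /= big_enum.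
(* The vector representing the coordinate functional at the place of [k] in [e], read off on the
   standard basis; it is 0 if [k] is not in [s]. *)
pose q k := \col_j \sum_i (tnth e i == k)%:R * coord X i (delta_mx 0 j).
have pq v k : pairing v (q k) = \sum_i (tnth e i == k)%:R * coord X i v.
  rewrite pairingE; under eq_bigr do rewrite mxE mulr_sumr.
  rewrite exchange_big /=; apply: eq_bigr => i _.
  rewrite [in RHS](row_sum_delta v) linear_sum mulr_sumr; apply: eq_bigr => j _.
  by rewrite linearZ /= mulrCA.
have inje : injective (tnth e) by apply/tuple_uniqP; rewrite enum_uniq.
have pqe v i : pairing v (q (tnth e i)) = coord X i v.
  rewrite pq (bigD1 i)//= eqxx mul1r big1 ?addr0// => i' /negPf ii'.
  by rewrite (inj_eq inje) ii' mul0r.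
exists q; split=> [j k|v].
  have es_e l : l \in s -> exists i, l = tnth e i.
    by rewrite -mem_enum => /(tnthP e)[i ->]; exists i.
  move=> /es_e[i ->] /es_e[i' ->].
  by rewrite pqe -Xi coord_free// (inj_eq inje).
rewrite sume [LHS](coord_basis bX (memvf v)).
by apply: eq_bigr => i _; rewrite pqe Xi.
Qed.

End DualSystem.

(** Shifting the values by [B] and truncating embeds [X] in a finite type of functions: equal
    truncations leave two values less than 1 apart, and integers less than 1 apart coincide. *)
Lemma finite_int_valued (R : realType) (W : Type) (I : finType) (X : set W)
    (f : W -> I -> R) (B : R) :
  (forall v i, X v -> f v i \is a Num.int) ->
  (forall v i, X v -> `|f v i| <= B) ->
  (forall u v, X u -> X v -> f u =1 f v -> u = v) ->
  finite_set X.
Proof.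
move=> fint fB finj; pose K := Num.truncn (B + B + 1).
pose g v : {ffun I -> 'I_K.+1} := [ffun i => inord (Num.truncn (f v i + B))].
pose C := [set g v | v in X].
have trunc_lt v i : X v -> (Num.truncn (f v i + B) < K.+1)%N.
  move=> Xv; have := fB v i Xv; rewrite ler_norml => /andP[f1 f2].
  by rewrite ltnS; apply: le_truncn; lra.
have finC : finite_set C by exact: finite_finset.
have injg : {in X &, injective g}.
  move=> u v /set_mem Xu /set_mem Xv guv; apply: finj => // i.
  have := congr1 (fun h : {ffun I -> 'I_K.+1} => val (h i)) guv.
  rewrite /= !ffunE !inordK ?trunc_lt// => tuv.
  have ge0 w : X w -> 0 <= f w i + B.
    by move=> Xw; have := fB w i Xw; rewrite ler_norml => /andP[f1 _]; lra.
  have := truncn_itv (ge0 _ Xu); have := truncn_itv (ge0 _ Xv).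
  rewrite tuv => /andP[v1 v2] /andP[u1 u2].
  have : f u i - f v i \is a Num.int by rewrite rpredB ?fint.
  case/intrP => m em.
  have : (m%:~R < 1%:~R :> R) /\ ((-1)%:~R < m%:~R :> R).
    by rewrite -em; move: u2 v2; rewrite -!natr1; split; lra.
  rewrite !ltr_int => -[m1 m2]; have m0 : m = 0 by lia.
  by apply/eqP; rewrite -subr_eq0 em m0.
by rewrite -(eq_finite_set (inj_card_eq injg)).
Qed.

Lemma subr_exchange (V : zmodType) (a b c d : V) : a - c = b - d -> a - b = c - d.
Proof.
move=> acbd; apply/eqP; rewrite subr_eq -(subrK c a) acbd.
by rewrite addrAC [c - d + b]addrAC [b + c]addrC.
Qed.

(** Translation by [w] permutes the classes of [G] modulo [H], and [F] depends only on the class.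
    For a character, the shift also multiplies the sum by a constant; when that constant is not 1,
    the sum vanishes. *)
Lemma transversal_sum_shift (W : zmodType) (K : nmodType) (H G T : set W) (w : W)
    (F : W -> K) :
  H 0 -> (forall a b, H a -> H b -> H (a - b)) ->
  T `<=` G -> (forall p, G p -> exists! q, T q /\ H (p - q)) ->
  (forall p, G p -> G (p + w)) -> (forall p, G p -> G (p - w)) ->
  (forall p q, H (p - q) -> F p = F q) ->
  \sum_(p \in T) F p = \sum_(p \in T) F (p + w).
Proof.
move=> H0 HB TG reps Gw GNw FH.
have HN a : H a -> H (- a) by move=> Ha; rewrite -[- a]add0r; exact: HB.
have HD a b : H a -> H b -> H (a + b) by move=> Ha Hb; rewrite -[b]opprK; exact/HB/HN.
have uniT p q : T p -> T q -> H (p - q) -> p = q.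
  move=> Tp Tq Hpq; have [r [_ ur]] := reps _ (TG _ Tp).
  by rewrite -(ur p) ?subrr// -(ur q).
(* [h p] is the representative of the class of [p + w]; the sum is reindexed along [h]. *)
have [h hP] : {h : W -> W & forall p, T p -> T (h p) /\ H (p + w - h p)}.
  apply: (@choice _ _ (fun p q => T p -> T q /\ H (p + w - q))) => p.
  case: (pselect (T p)) => [Tp|]; last by exists 0.
  by have [q [? _]] := reps _ (Gw _ (TG _ Tp)); exists q.
rewrite (@reindex_fsbig _ _ _ _ _ h T T).
  by apply: eq_fsbigr => p /set_mem Tp; apply/esym/FH; case: (hP _ Tp).
split.
- by move=> p Tp; case: (hP _ Tp).
- move=> p q /set_mem Tp /set_mem Tq hpq; apply: uniT => //.
  have := HB _ _ (hP _ Tp).2 (hP _ Tq).2; rewrite hpq.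
  by rewrite opprB addrA subrK opprD addrACA subrr addr0.
(* The preimage of [q] is the representative of the class of [q - w]. *)
- move=> q Tq; have [p [[Tp Hp] _]] := reps _ (GNw _ (TG _ Tq)).
  exists p => //; apply/esym/uniT => //; first by case: (hP _ Tp).
  have := HD _ _ Hp (hP _ Tp).2.
  by rewrite -(addrA q) -opprD (addrC w p) addrA subrK.
Qed.

Section IntegerSpan.
Variables (R : realType) (n N : nat) (Phi : N.-tuple 'rV[R]_n) (s : {set 'I_N}).

Definition int_span : set 'rV[R]_n :=
  [set \sum_(k in s) (z k)%:~R *: tnth Phi k | z in [set: 'I_N -> int]].

(** Dual to [int_span]: the differences of points of [Gset] are 2 pi i times such vectors. *)
Definition int_dual : set 'cV[R]_n :=
  [set w | forall k, k \in s -> pairing (tnth Phi k) w \is a Num.int].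

Variable q : 'I_N -> 'cV[R]_n.
Hypothesis dualq : dual_system Phi s q.

Lemma pairing_dual (t : 'I_N -> R) j : j \in s ->
  pairing (\sum_(k in s) t k *: tnth Phi k) (q j) = t j.
Proof.
move=> js; rewrite pairing_suml (bigD1 j)//= pairingZl dualq.1// eqxx mulr1.
rewrite big1 ?addr0// => k /andP[ks /negPf kj].
by rewrite pairingZl dualq.1// kj mulr0.
Qed.

Lemma pairing_dual_expand l w :
  pairing l w = \sum_(k in s) pairing l (q k) * pairing (tnth Phi k) w.
Proof.
rewrite [in LHS](dualq.2 l) pairing_suml.
by apply: eq_bigr => k _; rewrite pairingZl.
Qed.

Lemma int_spanP l :
  int_span l <-> forall k, k \in s -> pairing l (q k) \is a Num.int.
Proof.
split=> [[z _ <-] k ks|lint]; first by rewrite pairing_dual// intr_int.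
exists (fun k => Num.floor (pairing l (q k))) => //.
rewrite [RHS](dualq.2 l); apply: eq_bigr => k ks.
by rewrite floorK// lint.
Qed.

Lemma int_span0 : int_span 0.
Proof. by apply/int_spanP => k _; rewrite pairing0l. Qed.

Lemma int_spanB l l' : int_span l -> int_span l' -> int_span (l - l').
Proof.
move=> /int_spanP Hl /int_spanP Hl'; apply/int_spanP => k ks.
by rewrite pairingBl rpredB ?Hl ?Hl'.
Qed.

Lemma int_dual_dual k : k \in s -> int_dual (q k).
Proof. by move=> ks j js; rewrite dualq.1// natr_int. Qed.

(** The half-open parallelepiped on [s] in dual coordinates, a fundamental domain for translation by
    [int_span]. *)
Definition half_open : set 'rV[R]_n :=
  [set l | forall k, k \in s -> 0 <= pairing l (q k) < 1].

Definition lattice_floor (l : 'rV[R]_n) : 'rV[R]_n :=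
  \sum_(k in s) (Num.floor (pairing l (q k)))%:~R *: tnth Phi k.

Lemma lattice_floor_int l : int_span (lattice_floor l).
Proof. by exists (fun k => Num.floor (pairing l (q k))). Qed.

Lemma sub_lattice_floor l : half_open (l - lattice_floor l).
Proof.
move=> k ks; rewrite pairingBl pairing_dual//.
by have := floor_itv (pairing l (q k)); rewrite intrD; lra.
Qed.

(** The coordinates of [u] and [v] differ by integers strictly between -1 and 1. *)
Lemma half_open_inj u v : half_open u -> half_open v -> int_span (u - v) -> u = v.
Proof.
move=> Hu Hv /int_spanP uv; rewrite (dualq.2 u) (dualq.2 v).
apply: eq_bigr => k ks; congr (_ *: _); apply/eqP; rewrite -subr_eq0.
have := uv k ks; rewrite pairingBl => /intrP[m em]; rewrite em.
have : (m%:~R < 1%:~R :> R) /\ ((-1)%:~R < m%:~R :> R).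
  by rewrite -em; have := Hu k ks; have := Hv k ks; split; lra.
by rewrite !ltr_int => -[m1 m2]; have -> : m = 0 by lia.
Qed.

Lemma half_open0 : half_open 0.
Proof. by move=> k _; rewrite pairing0l lexx ltr01. Qed.

End IntegerSpan.

(** * Pairing real forms with complex points *)

Section ComplexPairing.
Variables (R : realType) (n : nat).
Implicit Types (l : 'rV[R]_n) (p : 'cV[R[i]]_n) (w : 'cV[R]_n).

Definition twopii_mx w : 'cV[R[i]]_n := map_mx (@twopii R) w.

Lemma twopii_mxB w w' : twopii_mx (w - w') = twopii_mx w - twopii_mx w'.
Proof. by apply/matrixP => i j; rewrite !mxE twopiiD twopiiN. Qed.

Lemma twopii_mx_inj : injective twopii_mx.
Proof.
move=> w w' /matrixP ww; apply/matrixP => i j; have := ww i j.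
rewrite !mxE => -[]; apply: mulfI; rewrite mulf_neq0// ?pnatr_eq0//.
by rewrite lt0r_neq0// pi_gt0.
Qed.

Lemma twopii_mx0 : twopii_mx 0 = 0 :> 'cV[R[i]]_n.
Proof. by apply/matrixP => i j; rewrite !mxE /twopii mulr0. Qed.

Lemma cpairingE l p : cpairing l p = \sum_i (l 0 i)%:C%C * p i 0.
Proof. by rewrite /cpairing mxE; apply: eq_bigr => i _; rewrite mxE. Qed.

Lemma cpairingDl l l' p : cpairing (l + l') p = cpairing l p + cpairing l' p.
Proof. by rewrite /cpairing map_mxD mulmxDl mxE. Qed.

Lemma cpairingNl l p : cpairing (- l) p = - cpairing l p.
Proof. by rewrite /cpairing map_mxN mulNmx mxE. Qed.

Lemma cpairing0l p : cpairing 0 p = 0.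
Proof. by rewrite /cpairing map_mx0 mul0mx mxE. Qed.

Lemma cpairingZl a l p : cpairing (a *: l) p = a%:C%C * cpairing l p.
Proof. by rewrite /cpairing map_mxZ -scalemxAl mxE. Qed.

Lemma cpairing_suml (I : Type) (r : seq I) (P : pred I) (F : I -> 'rV[R]_n) p :
  cpairing (\sum_(i <- r | P i) F i) p = \sum_(i <- r | P i) cpairing (F i) p.
Proof.
exact: (big_morph ((@cpairing R n)^~ p) (fun l l' => cpairingDl l l' p) (cpairing0l p)).
Qed.

Lemma cpairingDr l p p' : cpairing l (p + p') = cpairing l p + cpairing l p'.
Proof. by rewrite /cpairing mulmxDr mxE. Qed.

Lemma cpairingNr l p : cpairing l (- p) = - cpairing l p.
Proof. by rewrite /cpairing mulmxN mxE. Qed.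

Lemma cpairingZr l a p : cpairing l (a *: p) = a * cpairing l p.
Proof. by rewrite /cpairing -scalemxAr mxE. Qed.

Lemma cpairing0r l : cpairing l 0 = 0.
Proof. by rewrite /cpairing mulmx0 mxE. Qed.

Lemma cpairing_sumr (I : Type) (r : seq I) (P : pred I) (F : I -> 'cV[R[i]]_n) l :
  cpairing l (\sum_(i <- r | P i) F i) = \sum_(i <- r | P i) cpairing l (F i).
Proof. exact: (big_morph (@cpairing R n l) (cpairingDr l) (cpairing0r l)). Qed.

Lemma cpairing_real l w : cpairing l (map_mx (real_complex R) w) = (pairing l w)%:C%C.
Proof. by rewrite /cpairing -map_mxM mxE. Qed.

Lemma cpairing_twopii l w : cpairing l (twopii_mx w) = twopii (pairing l w).
Proof.
have -> : twopii_mx w = (twopii 1) *: map_mx (real_complex R) w.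
  apply/matrixP => i j; rewrite !mxE; apply/eqP; rewrite eq_complex/=.
  by apply/andP; split; apply/eqP; ring.
rewrite cpairingZr cpairing_real; apply/eqP; rewrite eq_complex/=.
by apply/andP; split; apply/eqP; ring.
Qed.

Lemma cpairing_eq p p' : (forall l, cpairing l p = cpairing l p') -> p = p'.
Proof.
have e i (v : 'cV[R[i]]_n) : cpairing (delta_mx 0 i) v = v i 0.
  rewrite cpairingE (bigD1 i)//= big1 ?addr0 ?mxE ?eqxx ?mul1r// => j /negPf ji.
  by rewrite mxE ji mul0r.
by move=> pp; apply/colP => i; rewrite -!e pp.
Qed.

End ComplexPairing.

(** * Character sums over lattice quotients *)

Section LatticeDuality.
Variables (R : realType) (n : nat) (Gamma : set 'cV[R]_n).

Lemma dual_latticeB l l' :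
  dual_lattice Gamma l -> dual_lattice Gamma l' -> dual_lattice Gamma (l - l').
Proof. by move=> Ll Ll' v Gv; rewrite pairingBl rpredB ?Ll ?Ll'. Qed.

Lemma dual_lattice0 : dual_lattice Gamma 0.
Proof. by move=> v _; rewrite pairing0l. Qed.

Lemma dual_lattice_sum (I : finType) (P : pred I) (z : I -> int) (F : I -> 'rV[R]_n) :
  (forall k, P k -> dual_lattice Gamma (F k)) ->
  dual_lattice Gamma (\sum_(k | P k) (z k)%:~R *: F k).
Proof.
move=> LF v Gv; rewrite pairing_suml rpred_sum// => k Pk.
by rewrite pairingZl rpredM ?intr_int// LF.
Qed.

Hypothesis lattice : is_full_lattice Gamma.

(* g is a Z-basis of Gamma and h is its dual basis. *)
Lemma full_lattice_coords : exists (g : 'I_n -> 'cV[R]_n) (h : 'I_n -> 'rV[R]_n),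
  [/\ forall v, v = \sum_i pairing (h i) v *: g i,
      forall i, dual_lattice Gamma (h i) &
      forall z : 'I_n -> int, Gamma (\sum_i (z i)%:~R *: g i)].
Proof.
case: lattice => g [bg Gammag].
pose h i : 'rV[R]_n := \row_j coord g i (delta_mx j 0).
have hE i v : pairing (h i) v = coord g i v.
  rewrite pairingE {2}[v]matrix_sum_delta linear_sum; apply: eq_bigr => j _.
  by rewrite big_ord1 linearZ /= mxE mulrC.
exists (tnth g), h; split => [v|i v|z].
- rewrite [LHS](coord_basis bg (memvf v)); apply: eq_bigr => i _.
  by rewrite hE (tnth_nth 0).
- rewrite Gammag => -[z _ <-]; rewrite hE linear_sum rpred_sum// => j _.
  rewrite -scaler_int linearZ/= rpredM ?intr_int// (tnth_nth 0) coord_free ?natr_int//.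
  exact: basis_free bg.
- by rewrite Gammag; exists z => //; apply: eq_bigr => i _; rewrite scaler_int.
Qed.

(** The coordinates of [v] in a Z-basis of [Gamma] are its pairings with the dual basis, whose
    members lie in the dual lattice. *)
Lemma dual_dual_lattice v :
  (forall l, dual_lattice Gamma l -> pairing l v \is a Num.int) -> Gamma v.
Proof.
have [g [h [gh hL Gg]]] := full_lattice_coords.
move=> vint; rewrite (gh v).
rewrite (eq_bigr (fun i => (Num.floor (pairing (h i) v))%:~R *: g i)) => [|i _].
  exact: Gg.
by rewrite floorK// vint.
Qed.

Lemma full_lattice0 : Gamma 0.
Proof. by apply: dual_dual_lattice => l _; rewrite pairing0r. Qed.

Lemma full_latticeB v w : Gamma v -> Gamma w -> Gamma (v - w).
Proof.
move=> Gv Gw; apply: dual_dual_lattice => l Ll.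
by rewrite -scaleN1r pairingDr pairingZr mulN1r rpredB ?Ll.
Qed.

End LatticeDuality.

Section CharacterSums.
Variables (R : realType) (n N : nat) (Gamma : set 'cV[R]_n).
Hypothesis lattice : is_full_lattice Gamma.
Variables (Phi : N.-tuple 'rV[R]_n) (s : {set 'I_N}).
Hypothesis Phi_dual : forall k : 'I_N, dual_lattice Gamma (tnth Phi k).
Variable q : 'I_N -> 'cV[R]_n.
Hypothesis dualq : dual_system Phi s q.
Variables (y : 'rV[R[i]]_N) (T : set 'cV[R[i]]_n).
Hypothesis repsT : is_representatives Gamma (Gset Phi y s) T.
Local Notation G := (Gset Phi y s).
Local Notation L := (dual_lattice Gamma).

Lemma int_span_dual l : int_span Phi s l -> L l.
Proof. by move=> [z _ <-]; apply: dual_lattice_sum. Qed.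

Lemma Gset_twopiiD p w : G p -> int_dual Phi s w -> G (p + twopii_mx w).
Proof.
move=> Gp wint k ks; rewrite cpairingDr cpairing_twopii cexpD Gp//.
by rewrite cexp_twopii_int ?mulr1// wint.
Qed.

(** The exponential of each pairing of [p - p'] with a form of [s] is 1, so these pairings are 2 pi
    i times integers [z k]; the combination of the [q k] with these coefficients is [w]. *)
Lemma Gset_sub p p' : G p -> G p' -> exists2 w, int_dual Phi s w & p = p' + twopii_mx w.
Proof.
move=> Gp Gp'.
have [z zP] : {z : 'I_N -> R & forall k, k \in s ->
    z k \is a Num.int /\ cpairing (tnth Phi k) p = cpairing (tnth Phi k) p' + twopii (z k)}.
  apply: (@choice _ _ (fun k a => k \in s -> a \is a Num.int /\
    cpairing (tnth Phi k) p = cpairing (tnth Phi k) p' + twopii a)) => k.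
  case: (boolP (k \in s)) => ks; last by exists 0.
  have : cexp (cpairing (tnth Phi k) p - cpairing (tnth Phi k) p') = 1.
    by rewrite cexpB Gp// Gp'// divff// cexp_neq0.
  by case/cexp_eq1 => a aint /eqP; rewrite subr_eq addrC => /eqP; exists a.
pose w := \sum_(k in s) z k *: q k.
have wz k : k \in s -> pairing (tnth Phi k) w = z k.
  move=> ks; rewrite pairing_sumr (bigD1 k)//= pairingZr dualq.1// eqxx mulr1.
  rewrite big1 ?addr0// => j /andP[js /negPf jk].
  by rewrite pairingZr dualq.1// eq_sym jk mulr0.
exists w => [k ks|]; first by rewrite wz//; case: (zP k ks).
apply: cpairing_eq => l; rewrite (dualq.2 l) !cpairing_suml.
apply: eq_bigr => k ks; rewrite !cpairingZl; congr (_ * _).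
by rewrite cpairingDr cpairing_twopii wz//; case: (zP k ks).
Qed.

Lemma reps_inj p p' w : T p -> T p' -> Gamma w -> p = p' + twopii_mx w -> p = p'.
Proof.
move=> Tp Tp' Gw pp'; have [r [_ ur]] := repsT.2 _ (repsT.1 _ Tp).
have Hp : T p /\ two_pi_i Gamma (p - p).
  by split=> //; exists 0; [exact: full_lattice0 | rewrite subrr; exact: twopii_mx0].
have Hp' : T p' /\ two_pi_i Gamma (p - p').
  by split=> //; exists w => //; rewrite pp' addrC addKr.
by rewrite -(ur _ Hp) (ur _ Hp').
Qed.

(** Relative to a base point [p0], each [p] is given by a vector [w p] of [int_dual]. Reduced modulo
    [Gamma] into a bounded cell, [w p] has bounded integral pairings with [s], and these determine
    it. *)
Lemma reps_finite : finite_set T.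
Proof.
have [[p0 Tp0]|noT] := pselect (T !=set0); last first.
  by rewrite (_ : T = set0)//; apply/seteqP; split=> // p Tp; apply: noT; exists p.
have [g [h [gh hL Gg]]] := full_lattice_coords lattice.
have /choice[w wP] p : exists w, T p -> int_dual Phi s w /\ p = p0 + twopii_mx w.
  case: (pselect (T p)) => [Tp|]; last by exists 0.
  by have [w] := Gset_sub (repsT.1 _ Tp) (repsT.1 _ Tp0); exists w.
pose fl v := \sum_i (Num.floor (pairing (h i) v))%:~R *: g i.
(* The factor [(k \in s)%:R] kills the indices off [s], where the pairing need not be integral. *)
pose f p k := (k \in s)%:R * pairing (tnth Phi k) (w p - fl (w p)).
have flE v : v - fl v = \sum_i (pairing (h i) v - (Num.floor (pairing (h i) v))%:~R) *: g i.
  by rewrite {1}(gh v) -sumrB; apply: eq_bigr => i _; rewrite scalerBl.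
apply: (@finite_int_valued R _ 'I_N T f (\sum_k \sum_i `|pairing (tnth Phi k) (g i)|)).
- move=> p k Tp; rewrite /f; case: (boolP (k \in s)) => ks; last by rewrite mul0r.
  rewrite mul1r -scaleN1r pairingDr pairingZr mulN1r rpredB//.
    by case: (wP p Tp) => + _; exact.
  exact/Phi_dual/Gg.
- move=> p k Tp; rewrite /f flE pairing_sumr.
  apply: (@le_trans _ _ (\sum_i `|pairing (tnth Phi k) (g i)|)); last first.
    by rewrite [leRHS](bigD1 k)//= lerDl sumr_ge0// => j _; rewrite sumr_ge0.
  rewrite normrM; apply: (@le_trans _ _ `|\sum_i pairing (tnth Phi k)
      ((pairing (h i) (w p) - (Num.floor (pairing (h i) (w p)))%:~R) *: g i)|).
    by rewrite ler_piMl// ger0_norm// lern1 leq_b1.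
  apply: le_trans (ler_norm_sum _ _ _) _; apply: ler_sum => i _.
  rewrite pairingZr normrM ler_piMl//.
  have := floor_itv (pairing (h i) (w p)); rewrite intrD => ?.
  by rewrite ger0_norm; lra.
- move=> p p' Tp Tp' ff.
  have fE k : k \in s -> pairing (tnth Phi k) (w p - fl (w p)) =
      pairing (tnth Phi k) (w p' - fl (w p')).
    by move=> ks; have := ff k; rewrite /f ks !mul1r.
  have ww : w p - fl (w p) = w p' - fl (w p').
    apply: twopii_mx_inj; apply: cpairing_eq => l.
    rewrite !cpairing_twopii !(pairing_dual_expand dualq l).
    by congr twopii; apply: eq_bigr => k ks; rewrite fE.
  have Gw : Gamma (w p - w p').
    rewrite (subr_exchange ww).
    by apply: full_latticeB => //; exact: Gg.
  apply: (reps_inj Tp Tp' Gw).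
  by rewrite twopii_mxB {1}(wP p' Tp').2 {1}(wP p Tp).2 addrACA subrr addr0.
Qed.

Lemma cexp_twopii_neq1 (a : R) : a \isn't a Num.int -> cexp (twopii a) != 1.
Proof.
move=> aNint; apply/eqP => /cexp_eq1[b bint] [] /mulfI.
rewrite mulf_neq0 ?pnatr_eq0 ?lt0r_neq0 ?pi_gt0// => /(_ isT) ab.
by rewrite ab bint in aNint.
Qed.

(** Some coordinate [pairing l (q k)] is not an integer. Translation by 2 pi i [q k] preserves [G]
    and multiplies the sum by a factor different from 1. *)
Lemma reps_sum_notin l : L l -> ~ int_span Phi s l ->
  \sum_(p \in T) cexp (- cpairing l p) = 0.
Proof.
move=> Ll lNint.
have [k [ks kNint]] : exists k, k \in s /\ pairing l (q k) \isn't a Num.int.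
  apply: contrapT => H; apply: lNint; apply/(int_spanP dualq) => k ks.
  by apply: contrapT => /negP kNint; apply: H; exists k.
have qint := int_dual_dual dualq ks.
have qNint : int_dual Phi s (- q k).
  by move=> j js; rewrite -scaleN1r pairingZr mulN1r rpredN qint.
have twN : twopii_mx (- q k) = - twopii_mx (q k).
  by rewrite -sub0r twopii_mxB twopii_mx0 sub0r.
have := @transversal_sum_shift _ _ (two_pi_i Gamma) G T (twopii_mx (q k))
  (fun p => cexp (- cpairing l p)).
move=> /(_ _ _ repsT.1 repsT.2); have H0 : two_pi_i Gamma 0.
  by exists 0; [exact: full_lattice0|exact: twopii_mx0].
have HB a b : two_pi_i Gamma a -> two_pi_i Gamma b -> two_pi_i Gamma (a - b).
  move=> [v Gv <-] [w Gw <-]; exists (v - w); first exact: full_latticeB.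
  exact: twopii_mxB.
move=> /(_ H0 HB) shift.
have {}shift := shift (fun p Gp => Gset_twopiiD Gp qint).
have {shift} := shift _ _.
have GN p : G p -> G (p - twopii_mx (q k)) by rewrite -twN => Gp; apply: Gset_twopiiD.
have Finv p p' : two_pi_i Gamma (p - p') -> cexp (- cpairing l p) = cexp (- cpairing l p').
  move=> [v Gv ev]; have -> : p = p' + twopii_mx v by rewrite [twopii_mx v]ev addrC subrK.
  by rewrite cpairingDr cpairing_twopii opprD cexpD -twopiiN cexp_twopii_int ?mulr1// rpredN Ll.
move=> /(_ GN Finv) shift.
set S := (X in X = 0).
have : S = S * cexp (- twopii (pairing l (q k))).
  rewrite {1}/S shift mulr_fsuml; apply: eq_fsbigr => p _.
  by rewrite cpairingDr opprD cpairing_twopii cexpD.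
rewrite -twopiiN -[X in X = _]mulr1 => /eqP; rewrite -subr_eq0 -mulrBr mulf_eq0 subr_eq0.
rewrite [1 == _]eq_sym (negPf (cexp_twopii_neq1 _)) ?orbF ?rpredN// => /eqP.
exact.
Qed.

(** On [G] the exponential of minus the [k]-th pairing is [cexp (y 0 k)], so on [int_span] the
    character does not depend on the point. *)
Lemma cexp_int_span (z : 'I_N -> int) p : G p ->
  cexp (- cpairing (\sum_(k in s) (z k)%:~R *: tnth Phi k) p)
  = \prod_(k in s) cexp (y 0 k) ^ z k.
Proof.
move=> Gp; rewrite cpairing_suml -sumrN cexp_sum; apply: eq_bigr => k ks.
have cexpMz (u : R[i]) (m : int) : cexp (u *~ m) = cexp u ^ m.
  by case: m => m; rewrite ?NegzE ?mulrNz ?cexpN -pmulrn cexpMn// -exprnN.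
rewrite cpairingZl -mulrN rmorph_int mulrzl cexpMz.
by rewrite cexpN (Gp k ks) -cexpN opprK.
Qed.

Lemma Gset_nonempty : exists p, G p.
Proof.
exists (\sum_(k in s) - y 0 k *: map_mx (real_complex R) (q k)) => j js.
rewrite cpairing_sumr (bigD1 j)//= cpairingZr cpairing_real dualq.1// eqxx mulr1.
rewrite big1 ?addr0// => k /andP[ks /negPf kj].
by rewrite cpairingZr cpairing_real dualq.1// eq_sym kj mulr0.
Qed.

(** Representatives of the dual lattice modulo [int_span]: their number is the order of the
    quotient. *)
Definition fundamental_points : set 'rV[R]_n := L `&` half_open s q.
Local Notation A := fundamental_points.

(** Pairings with a Z-basis of [Gamma] are integers that determine the point, and they are bounded
    because its coordinates lie in [0, 1[. *)
Lemma fundamental_points_finite : finite_set A.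
Proof.
have [g [h [gh hL Gg]]] := full_lattice_coords lattice.
apply: (@finite_int_valued R _ 'I_n A (fun l i => pairing l (g i))
   (\sum_i \sum_(k in s) `|pairing (tnth Phi k) (g i)|)).
- move=> l i [Ll _]; apply: Ll; have := Gg (fun j => (j == i)%:Z).
  rewrite (bigD1 i)//= eqxx scale1r big1 ?addr0// => j /negPf ->.
  by rewrite scale0r.
- move=> l i [_ Hl]; rewrite (pairing_dual_expand dualq).
  apply: (@le_trans _ _ (\sum_(k in s) `|pairing (tnth Phi k) (g i)|)); last first.
    by rewrite [leRHS](bigD1 i)//= lerDl sumr_ge0// => j _; rewrite sumr_ge0.
  apply: le_trans (ler_norm_sum _ _ _) _; apply: ler_sum => k ks.
  by rewrite normrM ler_piMl//; have := Hl k ks; move=> ?; rewrite ger0_norm; lra.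
- move=> l l' _ _ ll'; apply/rowP => i.
  have e j (u : 'rV[R]_n) : pairing u (delta_mx j 0) = u 0 j.
    rewrite pairingE (bigD1 j)//= big1 ?addr0 ?mxE ?eqxx ?mulr1// => k /negPf kj.
    by rewrite mxE kj mulr0.
  rewrite -!e (gh (delta_mx i 0)) !pairing_sumr; apply: eq_bigr => j _.
  by rewrite !pairingZr ll'.
Qed.

Lemma fundamental_points_reps l : L l ->
  exists! a, A a /\ int_span Phi s (l - a).
Proof.
move=> Ll; exists (l - lattice_floor Phi s q l); split.
  split; last by rewrite opprB addrC subrK; exact: lattice_floor_int.
  split; last exact: sub_lattice_floor.
  by apply: dual_latticeB => //; apply: int_span_dual; exact: lattice_floor_int.
move=> a [[La Ha] la]; apply: (half_open_inj dualq) => //; first exact: sub_lattice_floor.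
rewrite addrAC; apply: (int_spanB dualq) => //; exact: lattice_floor_int.
Qed.

(** Here [p - p'] is 2 pi i times a vector [w] outside [Gamma], so some [a0] in the dual lattice
    pairs non-integrally with [w]. Translation by [a0] multiplies the sum by a factor different from
    1. *)
Lemma fundamental_points_sum_neq p p' : T p -> T p' -> p != p' ->
  \sum_(a \in A) cexp (- cpairing a (p - p')) = 0.
Proof.
move=> Tp Tp' pp'.
have [w wint epp] := Gset_sub (repsT.1 _ Tp) (repsT.1 _ Tp').
have -> : p - p' = twopii_mx w by rewrite epp addrC addKr.
have [a0 [La0 aNint]] : exists a0, L a0 /\ pairing a0 w \isn't a Num.int.
  apply: contrapT => H; move/eqP: pp'; apply.
  apply: (reps_inj Tp Tp' _ epp); apply: dual_dual_lattice => // l Ll.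
  by apply: contrapT => /negP kNint; apply: H; exists l.
have LN0 : L (- a0) by rewrite -sub0r; apply: dual_latticeB => //; exact: dual_lattice0.
have shift := @transversal_sum_shift _ _ (int_span Phi s) L A a0
  (fun a => cexp (- cpairing a (twopii_mx w))) (int_span0 dualq) (int_spanB dualq).
have AL : A `<=` L by move=> a [].
have {}shift := shift AL fundamental_points_reps.
set S := (X in X = 0).
have : S = S * cexp (- twopii (pairing a0 w)).
  rewrite {1}/S shift.
  - rewrite mulr_fsuml; apply: eq_fsbigr => a _.
    by rewrite cpairingDl opprD cexpD (cpairing_twopii a0).
  - by move=> a La; have := dual_latticeB La LN0; rewrite opprK.
  - by move=> a La; exact: dual_latticeB La La0.
  - move=> a b /(int_spanP dualq) ab; have -> : a = b + (a - b) by rewrite addrC subrK.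
    rewrite cpairingDl opprD cexpD (cpairing_twopii (a - b)) -twopiiN.
    have -> : cexp (twopii (- pairing (a - b) w)) = 1.
      apply: cexp_twopii_int; rewrite rpredN (pairing_dual_expand dualq).
      by rewrite rpred_sum// => k ks; apply: rpredM; [exact: ab | exact: wint].
    by rewrite mulr1.
rewrite -twopiiN -[X in X = _]mulr1 => /eqP; rewrite -subr_eq0 -mulrBr mulf_eq0 subr_eq0.
rewrite [1 == _]eq_sym (negPf (cexp_twopii_neq1 _)) ?orbF ?rpredN// => /eqP.
exact.
Qed.

Lemma fundamental_points0 : A 0.
Proof. by split; [exact: dual_lattice0 | exact: half_open0]. Qed.

(* Orthogonality of the characters of the finite group dual_lattice / int_span,
   summed over both variables. *)
Lemma card_reps : \sum_(p \in T) (1 : R[i]) = \sum_(a \in A) (1 : R[i]).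
Proof.
have [p0 Tp0] : exists p, T p.
  have [p Gp] := Gset_nonempty; have [r [[Tr _] _]] := repsT.2 _ Gp.
  by exists r.
have finT := reps_finite.
have finA := fundamental_points_finite.
(* Summing over [a] first leaves only [p = p0], which counts [A]; summing over [p] first leaves only
   [a = 0], which counts [T]. *)
have := @exchange_fsbig _ 0 +%R _ _ T A (fun p a => cexp (- cpairing a (p - p0))) finT finA.
rewrite (fsbigD1 p0)//= [X in _ + X]fsbig1 ?addr0; last first.
  by move=> p [Tp /eqP pp0]; apply: fundamental_points_sum_neq.
under eq_fsbigr do rewrite subrr cpairing0r oppr0 cexp0.
rewrite [in RHS](fsbigD1 0)//=; last exact: fundamental_points0.
rewrite [X in _ = _ + X]fsbig1 ?addr0.
  by under [in RHS]eq_fsbigr do rewrite cpairing0l oppr0 cexp0.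
move=> a [[La Ha] a0].
under eq_fsbigr do rewrite cpairingDr cpairingNr opprD cexpD.
rewrite -mulr_fsuml reps_sum_notin ?mul0r// => aint; apply: a0.
by apply: (half_open_inj dualq) => //; [exact: half_open0 | rewrite subr0].
Qed.

End CharacterSums.

(** * Volumes of zonotopes *)

Section InvariantMeasure.
Variables (R : realType) (n : nat) (vol : {measure set (borel_dual R n) -> \bar R}).
Local Notation measurable := (measurable : set (set (borel_dual R n))).
Hypothesis vol_trans : forall (v : 'rV[R]_n) (A : set 'rV[R]_n),
  measurable A -> vol [set v + x | x in A] = vol A.

Lemma measurable_lt_pairing (v : 'cV[R]_n) (a : R) :
  measurable [set l | pairing l v < a].
Proof.
apply: sub_sigma_algebra; apply: (@open_comp _ _ _ [set x : R | x < a]).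
  by move=> l _; exact: pairing_continuous.
exact: open_lt.
Qed.

Lemma measurable_ge_pairing (v : 'cV[R]_n) (a : R) :
  measurable [set l | a <= pairing l v].
Proof.
rewrite (_ : [set l | _] = ~` [set l | pairing l v < a]).
  by apply: measurableC; exact: measurable_lt_pairing.
by apply/seteqP; split=> l /=; rewrite leNgt => /negP.
Qed.

Lemma measurable_le_pairing (v : 'cV[R]_n) (a : R) :
  measurable [set l | pairing l v <= a].
Proof.
rewrite (_ : [set l | _] = [set l | - a <= pairing l (- v)]).
  exact: measurable_ge_pairing.
by apply/seteqP; split=> l /=; rewrite pairingNr lerN2.
Qed.

(** Two fundamental domains are equidecomposable: [A] is cut along the translates of [B], and the
    piece of index [z], moved by [- t z], is a piece of [B] cut along the translates of [A]. *)
Lemma vol_fundamental_domain (Z : countType) (D : set Z) (t : Z -> 'rV[R]_n)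
    (A B : set 'rV[R]_n) :
  measurable A -> measurable B ->
  (forall z, measurable [set v | A (v + t z)]) ->
  (forall z, measurable [set v | B (v - t z)]) ->
  (forall v, exists! z, D z /\ A (v + t z)) ->
  (forall v, exists! z, D z /\ B (v - t z)) ->
  vol A = vol B.
Proof.
move=> mA mB mAt mBt tileA tileB.
(* Countable additivity is over [nat], so the pieces are numbered by [pickle], with empty pieces at
   numbers that encode nothing. *)
pose F i := if pickle_inv i is Some z then [set v | D z /\ (A v /\ B (v - t z))] else set0.
pose H i := if pickle_inv i is Some z then [set v | D z /\ (A (v + t z) /\ B v)] else set0.
have AF : A = \bigcup_i F i.
  apply/seteqP; split=> [v Av|v [i _]]; last by rewrite /F; case: pickle_inv => // z [_ []].
  have [z [[Dz Bz] _]] := tileB v.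
  by exists (pickle z) => //; rewrite /F pickleK_inv.
have BH : B = \bigcup_i H i.
  apply/seteqP; split=> [v Bv|v [i _]]; last by rewrite /H; case: pickle_inv => // z [_ []].
  have [z [[Dz Az] _]] := tileA v.
  by exists (pickle z) => //; rewrite /H pickleK_inv.
have setD z (P : set 'rV[R]_n) : measurable P -> measurable [set v | D z /\ P v].
  move=> mP; have [Dz|nDz] := pselect (D z).
    by rewrite (_ : [set v | _] = P)//; apply/seteqP; split=> [v [_]|v Pv].
  by rewrite (_ : [set v | _] = set0)//; apply/seteqP; split=> [v [/nDz]|v].
have mF i : measurable (F i).
  rewrite /F; case: pickle_inv => // z.
  by apply: (setD z (A `&` [set v | B (v - t z)])); apply: measurableI.
have mH i : measurable (H i).
  rewrite /H; case: pickle_inv => // z.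
  by apply: (setD z ([set v | A (v + t z)] `&` B)); apply: measurableI.
have pick_inj a b (z : Z) : pickle_inv a = Some z -> pickle_inv b = Some z -> a = b.
  move=> iz jz; have pK m : oapp pickle m (@pickle_inv Z m) = m by exact: pickle_invK.
  by rewrite -[a]pK -[b]pK iz jz.
have tF : trivIset setT F.
  move=> i j _ _ [v []]; rewrite /F; case ei: (pickle_inv i) => [z|//] [Dz [_ Bz]].
  case ej: (pickle_inv j) => [z'|//] [Dz' [_ Bz']].
  have [r [_ ur]] := tileB v; apply: (pick_inj i j z ei).
  by rewrite ej -(ur z) ?(ur z').
have tH : trivIset setT H.
  move=> i j _ _ [v []]; rewrite /H; case ei: (pickle_inv i) => [z|//] [Dz [Az _]].
  case ej: (pickle_inv j) => [z'|//] [Dz' [Az' _]].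
  have [r [_ ur]] := tileA v; apply: (pick_inj i j z ei).
  by rewrite ej -(ur z) ?(ur z').
rewrite AF BH !measure_bigcup//; apply: eq_eseriesr => i _.
rewrite /F /H; case ei: (pickle_inv i) => [z|//].
rewrite -(vol_trans (- t z)); last by have := mF i; rewrite /F ei.
congr (vol _); apply/seteqP; split=> [w [v [Dz [Av Bv]] <-]|v [Dz [Av Bv]]] /=.
  by rewrite (addrC (- t z) v) subrK.
by exists (v + t z); rewrite /= ?addrK// addrC addrK.
Qed.

(** Every multiple [m * vol A] is at most the finite volume of [C]. *)
Lemma vol_disjoint_translates (A C : set 'rV[R]_n) (u : nat -> 'rV[R]_n) :
  measurable A -> measurable C -> (vol C < +oo)%E ->
  (forall m, measurable [set u m + x | x in A]) ->
  trivIset setT (fun m => [set u m + x | x in A]) ->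
  (forall m, [set u m + x | x in A] `<=` C) ->
  vol A = 0%E.
Proof.
move=> mA mC finC mAu tAu AuC.
have fA : vol A \is a fin_num.
  rewrite ge0_fin_numE//; apply: le_lt_trans finC; rewrite -(vol_trans (u 0%N) mA).
  by apply: le_measure; rewrite ?inE//; exact: AuC.
have bound m : ((m%:R * fine (vol A))%:E <= vol C)%E.
  have -> : (m%:R * fine (vol A))%:E = vol (\bigcup_(i in `I_m) [set u i + x | x in A]).
    rewrite measure_fin_bigcup//; last exact: sub_trivIset tAu.
    rewrite -fsbig_ord (eq_bigr (fun=> (fine (vol A))%:E)) => [|i _]; last first.
      by rewrite fineK//; exact: vol_trans.
    by rewrite sumEFin sumr_const card_ord mulr_natl.
  apply: le_measure; rewrite ?inE//.
    by apply: fin_bigcup_measurable => // i _; exact: mAu.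
  by move=> x [i _]; exact: AuC.
have fC : vol C \is a fin_num by rewrite ge0_fin_numE.
have A0 : 0 <= fine (vol A) by rewrite fine_ge0.
rewrite -(fineK fA); congr EFin; apply/eqP/negPn/negP => An0.
have Apos : 0 < fine (vol A) by rewrite lt_neqAle eq_sym An0.
have := bound (Num.truncn (fine (vol C) / fine (vol A))).+1.
rewrite -(fineK fC) lee_fin leNgt -ltr_pdivrMr//.
by rewrite truncnS_gt.
Qed.

End InvariantMeasure.

Lemma image_addl (W : zmodType) (u : W) (A : set W) :
  [set u + x | x in A] = [set v | A (v - u)].
Proof.
apply/seteqP; split=> [_ [x Ax <-]|v Av] /=; first by rewrite addrC addKr.
by exists (v - u) => //; rewrite addrC subrK.
Qed.

Section LatticeVolume.
Variables (R : realType) (n : nat) (Gamma : set 'cV[R]_n).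
Hypothesis lattice : is_full_lattice Gamma.
Variable vol : {measure set (borel_dual R n) -> \bar R}.
Local Notation measurable := (measurable : set (set (borel_dual R n))).
Hypothesis vol_trans : forall (v : 'rV[R]_n) (A : set 'rV[R]_n),
  measurable A -> vol [set v + x | x in A] = vol A.
Local Notation L := (dual_lattice Gamma).

Lemma measurable_half_open (N : nat) (s : {set 'I_N}) (q : 'I_N -> 'cV[R]_n) u :
  measurable [set v | half_open s q (v + u)].
Proof.
rewrite (_ : [set v | _] = \bigcap_(k in [set` s])
   ([set v | - pairing u (q k) <= pairing v (q k)]
    `&` [set v | pairing v (q k) < 1 - pairing u (q k)])).
  apply: fin_bigcap_measurable => // k _; apply: measurableI.
    exact: measurable_ge_pairing.
  exact: measurable_lt_pairing.
apply/seteqP; split=> v Hv k ks; have := Hv k ks; rewrite pairingDl /=.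
  by move=> ?; split; lra.
by move=> []; lra.
Qed.

Variables (b : n.-tuple 'rV[R]_n) (qb : 'I_n -> 'cV[R]_n).
Hypothesis dualb : dual_system b [set: 'I_n]%SET qb.
Hypothesis spanb : L = int_span b [set: 'I_n]%SET.

Section Config.
Variables (N : nat) (Phi : N.-tuple 'rV[R]_n) (s : {set 'I_N}).
Hypothesis Phi_dual : forall k : 'I_N, L (tnth Phi k).
Variable q : 'I_N -> 'cV[R]_n.
Hypothesis dualq : dual_system Phi s q.
Local Notation A := (fundamental_points Gamma s q).

(** Both [half_open s q] and the union [B] of the cells [a + Q], for [a] in [A], are fundamental
    domains for [int_span Phi s]: the translates of [Q] by [L] tile the space, and [A] represents
    [L] modulo [int_span]. *)
Lemma vol_half_open :
  vol (half_open s q) = (\sum_(a \in A) vol (half_open [set: 'I_n]%SET qb))%E.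
Proof.
have finA := fundamental_points_finite lattice dualq.
pose Q := half_open [set: 'I_n]%SET qb.
pose B := \bigcup_(a in A) [set a + x | x in Q].
have mQ (u : 'rV[R]_n) : measurable [set v | Q (v - u)] by exact: measurable_half_open.
have mBu u : measurable [set v | B (v - u)].
  rewrite (_ : [set v | _] = \bigcup_(a in A) [set v | Q (v - (u + a))]).
    exact: fin_bigcup_measurable.
  apply/seteqP; split=> v [a Aa]; exists a => //; move: q0.
    by rewrite image_addl/= opprD addrA.
  by rewrite image_addl/= opprD addrA.
have volB : vol B = (\sum_(a \in A) vol Q)%E.
  rewrite measure_fin_bigcup//.
  - by apply: eq_fsbigr => a _; apply: vol_trans; have := mQ 0; under eq_set do rewrite subr0.
  - move=> a a' Aa Aa' [v []]; rewrite !image_addl => Qa Qa'.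
    have vv : v - a = v - a'.
      apply: (half_open_inj dualb) => //; rewrite -spanb.
      by rewrite opprB addrC addrA subrK; apply: dual_latticeB; [case: Aa'|case: Aa].
    by have := congr1 (fun x => v - x) vv; rewrite !subKr.
  - by move=> a Aa; rewrite image_addl.
rewrite -volB.
(* Coefficients off [s] do not affect [t]; setting them to 0 makes the index of a translation
   unique. *)
pose D := [set z : {ffun 'I_N -> int} | forall k, k \notin s -> z k = 0].
pose t (z : {ffun 'I_N -> int}) := \sum_(k in s) (z k)%:~R *: tnth Phi k.
have t_inj z z' : D z -> D z' -> t z = t z' -> z = z'.
  move=> Dz Dz' tt; apply/ffunP => k; have [ks|ks] := boolP (k \in s); last by rewrite Dz// Dz'.
  by apply: (@intr_inj R); rewrite -[LHS](pairing_dual dualq (fun j => (z j)%:~R) ks)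
     -[RHS](pairing_dual dualq (fun j => (z' j)%:~R) ks) -/(t z) tt.
have tL z : int_span Phi s (t z) by exists z.
apply: (@vol_fundamental_domain _ _ vol vol_trans _ D t).
- have := measurable_half_open s q 0; by under eq_set do rewrite addr0.
- by have := mBu 0; under eq_set do rewrite subr0.
- by move=> z; exact: measurable_half_open.
- by move=> z; exact: mBu.
- move=> v; pose z := [ffun k => if k \in s then - Num.floor (pairing v (q k)) else 0].
  exists z; split.
    split; first by move=> k /negPf ks; rewrite ffunE ks.
    rewrite (_ : v + t z = v - lattice_floor Phi s q v); first exact: sub_lattice_floor.
    congr (_ + _); rewrite -sumrN; apply: eq_bigr => k ks.
    by rewrite ffunE ks intrN scaleNr.
  move=> z' [Dz' Hz']; apply/ffunP => k; rewrite ffunE; case: ifPn => ks; last by rewrite Dz'.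
  apply/eqP; rewrite eqr_oppLR; apply/eqP; apply: floor_def.
  have := Hz' k ks; rewrite pairingDl (pairing_dual dualq (fun j => (z' j)%:~R))//.
  by rewrite intrD intrN; lra.
(* [l] is the lattice point with [v - l] in [Q]; its representative [a] selects the cell, and
   [l - a] is the translation. *)
- move=> v; pose l := lattice_floor b [set: 'I_n]%SET qb v.
  have Ll : L l by rewrite spanb; exact: lattice_floor_int.
  have [a [[Aa [z0 _ la]] ua]] := fundamental_points_reps Phi_dual dualq Ll.
  pose z : {ffun 'I_N -> int} := [ffun k => if k \in s then z0 k else 0].
  have tz : t z = l - a.
    by rewrite -la; apply: eq_bigr => k ks; rewrite ffunE ks.
  exists z; split.
    split; first by move=> k /negPf ks; rewrite ffunE ks.
    exists a => //; rewrite image_addl /= tz opprB addrA addrAC addrK.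
    exact: (sub_lattice_floor dualb).
  move=> z' [Dz' [a' Aa']]; rewrite image_addl /= => Qz'.
  have la' : v - t z' - a' = v - l.
    apply: (half_open_inj dualb) => //; first exact: (sub_lattice_floor dualb).
    rewrite -spanb opprB -(addrA v) -opprD [X in L X]addrC addrA subrK.
    apply: dual_latticeB => //; rewrite -[a']opprK; apply: dual_latticeB.
      exact: (int_span_dual Phi_dual).
    by rewrite -sub0r; apply: dual_latticeB; [exact: dual_lattice0|case: Aa'].
  have ltz : l = t z' + a'.
    by apply: oppr_inj; apply: (addrI v); rewrite -la' opprD addrA.
  have aa' : a = a' by apply: ua; split=> //; rewrite ltz addrK.
  apply: t_inj => //; first by move=> k /negPf ks; rewrite ffunE ks.
  by rewrite tz ltz aa' addrK.
Qed.

Lemma zonotopeP v :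
  zonotope Phi s v <-> forall k, k \in s -> 0 <= pairing v (q k) <= 1.
Proof.
split=> [[t t01 <-] k ks|Hv]; first by rewrite (pairing_dual dualq).
exists (fun k => if k \in s then pairing v (q k) else 0) => [k|].
  by case: ifPn => [/Hv|_]; rewrite ?lexx ?ler01.
by rewrite [RHS](dualq.2 v); apply: eq_bigr => k ks; rewrite ks.
Qed.

Lemma measurable_zonotope : measurable (zonotope Phi s).
Proof.
rewrite (_ : zonotope Phi s = \bigcap_(k in [set` s])
   ([set v | 0 <= pairing v (q k)] `&` [set v | pairing v (q k) <= 1])).
  apply: fin_bigcap_measurable => // k _; apply: measurableI.
    exact: measurable_ge_pairing.
  exact: measurable_le_pairing.
by apply/seteqP; split=> v => [/zonotopeP Hv k /Hv /andP[]//|Hv];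
  apply/zonotopeP => k /Hv [/= -> ->].
Qed.

End Config.

End LatticeVolume.

Section ZonotopeVolume.
Variables (R : realType) (n : nat) (Gamma : set 'cV[R]_n).
Hypothesis lattice : is_full_lattice Gamma.
Variable vol : {measure set (borel_dual R n) -> \bar R}.
Hypothesis vol_normalized : is_lattice_volume (dual_lattice Gamma) vol.
Local Notation measurable := (measurable : set (set (borel_dual R n))).
Local Notation L := (dual_lattice Gamma).

Lemma lattice_volume_basis : exists (b : n.-tuple 'rV[R]_n) (qb : 'I_n -> 'cV[R]_n),
  [/\ dual_system b [set: 'I_n]%SET qb, L = int_span b [set: 'I_n]%SET
    & vol (zonotope b [set: 'I_n]%SET) = 1%E].
Proof.
have [_ [b [[bb Lb] volb]]] := vol_normalized.
have : bases b [set: 'I_n]%SET.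
  split; first by rewrite cardsT card_ord.
  rewrite (_ : [seq _ | _ <- _] = b); first exact: basis_free bb.
  by rewrite enum_setT -enumT map_tnth_enum.
case/bases_dual_system => qb dualb; exists b, qb; split=> //.
rewrite Lb; apply/seteqP; split=> l [z _ <-]; exists z => //.
  by apply: eq_big => [i|i _]; rewrite ?inE// scaler_int.
by apply: eq_big => [i|i _]; rewrite ?inE// scaler_int.
Qed.

(** The volume is that of finitely many copies of a cell contained in a zonotope of volume 1. *)
Lemma vol_half_open_fin (N : nat) (Phi : N.-tuple 'rV[R]_n) (s : {set 'I_N})
    (q : 'I_N -> 'cV[R]_n) :
  (forall k, L (tnth Phi k)) -> dual_system Phi s q ->
  (vol (half_open s q) < +oo)%E.
Proof.
move=> Phi_dual dualq; have [b [qb [dualb spanb volb]]] := lattice_volume_basis.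
rewrite (vol_half_open lattice vol_normalized.1 dualb spanb Phi_dual dualq).
have finQ : vol (half_open [set: 'I_n]%SET qb) \is a fin_num.
  rewrite ge0_fin_numE//; apply: (@le_lt_trans _ _ 1%E); last exact: ltry.
  rewrite -volb; apply: le_measure; rewrite ?inE.
  - by have := measurable_half_open [set: 'I_n]%SET qb 0; under eq_set do rewrite addr0.
  - exact: measurable_zonotope dualb.
  - by move=> v Hv; apply/(zonotopeP dualb) => k ks; have /andP[-> /ltW] := Hv k ks.
have finA := fundamental_points_finite lattice dualq.
by rewrite fsbig_finite// -(fineK finQ) sumEFin ltry.
Qed.

Section Config.
Variables (N : nat) (Phi : N.-tuple 'rV[R]_n) (s : {set 'I_N}).
Hypothesis Phi_dual : forall k : 'I_N, L (tnth Phi k).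
Variable q : 'I_N -> 'cV[R]_n.
Hypothesis dualq : dual_system Phi s q.

(** The closed parallelepiped lies in the half-open one on the doubled vectors. *)
Lemma vol_zonotope_fin : (vol (zonotope Phi s) < +oo)%E.
Proof.
pose Phi2 := map_tuple ( *:%R (2 : R)) Phi; pose q2 k := 2^-1 *: q k.
have two0 : 2 != 0 :> R by rewrite pnatr_eq0.
have dual2 : dual_system Phi2 s q2.
  split=> [j k js ks|v].
    by rewrite tnth_map pairingZl pairingZr mulVKf// dualq.1.
  rewrite [LHS](dualq.2 v); apply: eq_bigr => k _.
  by rewrite tnth_map pairingZr scalerA mulrAC mulVf// mul1r.
have Phi2_dual k : L (tnth Phi2 k).
  by move=> v Gv; rewrite tnth_map pairingZl rpredM ?natr_int// Phi_dual.
apply: le_lt_trans (vol_half_open_fin Phi2_dual dual2).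
apply: le_measure; rewrite ?inE.
- exact: measurable_zonotope dualq.
- by have := measurable_half_open s q2 0; under eq_set do rewrite addr0.
- move=> v /(zonotopeP dualq) Hv k ks; rewrite pairingZr.
  by have := Hv k ks => ?; apply/andP; split; lra.
Qed.

(** The closed parallelepiped adds to the half-open one the faces where some coordinate is 1. Moving
    such a face inwards along its vector by distinct amounts in ]0, 1] gives disjoint translates
    inside the parallelepiped, so the face is null. *)
Lemma vol_zonotope : vol (zonotope Phi s) = vol (half_open s q).
Proof.
pose face j := [set v | zonotope Phi s v /\ 1 <= pairing v (q j)].
have mZ : measurable (zonotope Phi s) by exact: measurable_zonotope dualq.
have mface j : measurable (face j).
  exact: (measurableI _ _ mZ (measurable_ge_pairing (q j) 1)).
have mH : measurable (half_open s q).
  by have := measurable_half_open s q 0; under eq_set do rewrite addr0.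
have face0 j : j \in s -> vol (face j) = 0%E.
  move=> js.
  have [eps [eps01 eps_inj]] : exists eps : nat -> R,
      (forall m, 0 < eps m <= 1) /\ injective eps.
    exists (fun m => m.+1%:R^-1); split=> [m|m m' /invr_inj/eqP].
      by rewrite invr_gt0 ltr0n invf_le1 ?ltr0n//= ler1n.
    by rewrite eqr_nat => /eqP[].
  pose u m : 'rV[R]_n := - (eps m *: tnth Phi j).
  have pu m v k : k \in s -> pairing (v - u m) (q k) = pairing v (q k) + eps m * (j == k)%:R.
    by move=> ks; rewrite pairingBl pairingNl opprK pairingZl dualq.1.
  apply: (@vol_disjoint_translates _ _ vol vol_normalized.1 _ (zonotope Phi s) u) => //.
  - exact: vol_zonotope_fin.
  - move=> m; rewrite image_addl.
    rewrite (_ : [set v | _] = \bigcap_(k in [set` s])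
       ([set v | - (eps m * (j == k)%:R) <= pairing v (q k)]
       `&` [set v | pairing v (q k) <= 1 - eps m * (j == k)%:R])
       `&` [set v | 1 - eps m <= pairing v (q j)]).
      apply: measurableI; last exact: measurable_ge_pairing.
      apply: fin_bigcap_measurable => // k _; apply: measurableI.
        exact: measurable_ge_pairing.
      exact: measurable_le_pairing.
    apply/seteqP; split=> v /=.
      move=> [/(zonotopeP dualq) Hv]; rewrite pu// eqxx mulr1 => vj.
      split=> [k ks|]; last by lra.
      by have := Hv k ks; rewrite pu//= => /andP[? ?]; split; lra.
    move=> [Hv vj]; split; last by rewrite pu// eqxx mulr1; lra.
    by apply/(zonotopeP dualq) => k ks; rewrite pu//; have [/= ? ?] := Hv k ks; lra.
  - move=> m m' _ _ [v []]; rewrite !image_addl /=.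
    move=> -[/(zonotopeP dualq) + vm] [/(zonotopeP dualq) + vm'].
    move=> /(_ j js) + /(_ j js); move: vm vm'; rewrite !pu// eqxx !mulr1 => ? ? ? ?.
    by apply: eps_inj; lra.
  - move=> m v; rewrite image_addl => -[/(zonotopeP dualq) Hv vj].
    apply/(zonotopeP dualq) => k ks; have := Hv k ks; have := eps01 m; move: vj.
    by rewrite !pu// eqxx mulr1; case: eqP => [<-|_]; rewrite ?mulr1 ?mulr0; lra.
pose F := \bigcup_(j in [set` s]) face j.
have mF : measurable F by apply: fin_bigcup_measurable.
have volF : vol F = 0%E.
  apply/eqP; rewrite eq_le measure_ge0 andbT.
  apply: (@le_trans _ _ (\sum_(j \in [set` s]) vol (face j))%E).
    by apply: content_sub_fsum.
  by rewrite fsbig1// => j; exact: face0.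
rewrite -(@measureU0 _ _ _ vol (half_open s q) F)//; congr (vol _).
apply/seteqP; split=> v.
  move=> Zv; have [vF|vNF] := pselect (F v); [by right|left => k ks].
  move/(zonotopeP dualq): (Zv) => /(_ k ks) /andP[-> _] /=.
  by rewrite ltNge; apply/negP => vk; apply: vNF; exists k.
case=> [Hv|[j _ []]//].
by apply/(zonotopeP dualq) => k ks; have /andP[-> /ltW] := Hv k ks.
Qed.

End Config.

(** The volume is the number of fundamental points times the volume of the basis cell, which the
    normalization makes 1; [card_reps] turns this number into that of the representatives. *)
Lemma vol_zonotope_reps (N : nat) (Phi : N.-tuple 'rV[R]_n) (s : {set 'I_N})
    (q : 'I_N -> 'cV[R]_n) (y : 'rV[R[i]]_N) (T : set 'cV[R[i]]_n) :
  (forall k, L (tnth Phi k)) -> dual_system Phi s q ->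
  is_representatives Gamma (Gset Phi y s) T ->
  (fine (vol (zonotope Phi s)))%:C%C = \sum_(p \in T) (1 : R[i]).
Proof.
move=> Phi_dual dualq repsT; have [b [qb [dualb spanb volb]]] := lattice_volume_basis.
have b_dual k : L (tnth b k).
  rewrite spanb; exists (fun i => (i == k)%:Z) => //.
  rewrite (bigD1 k) ?inE//= eqxx scale1r big1 ?addr0// => i /andP[_ /negPf ->].
  by rewrite scale0r.
rewrite (vol_zonotope Phi_dual dualq).
rewrite (vol_half_open lattice vol_normalized.1 dualb spanb Phi_dual dualq).
rewrite -(vol_zonotope b_dual dualb) volb (card_reps lattice Phi_dual dualq repsT).
have finA := fundamental_points_finite lattice dualq.
by rewrite !fsbig_finite// sumEFin rmorph_sum; apply: eq_bigr => a _; rewrite rmorph1.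
Qed.

End ZonotopeVolume.

(** * Cones and chambers *)

Section Cones.
Variables (R : realType) (n N : nat) (Phi : N.-tuple 'rV[R]_n).
Implicit Types (A s nu : {set 'I_N}) (x : 'rV[R]_n).

Lemma cone_restrict A (t : 'I_N -> R) : (forall k, k \in A -> 0 <= t k) ->
  cone Phi A (\sum_(k in A) t k *: tnth Phi k).
Proof.
move=> t0; exists (fun k => if k \in A then t k else 0) => [k|].
  by case: ifPn => // /t0.
by apply: eq_bigr => k ->.
Qed.

Lemma coneP A x : cone Phi A x ->
  exists2 t : 'I_N -> R, forall k, 0 <= t k & x = \sum_(k in A) t k *: tnth Phi k.
Proof. by move=> [t t0 <-]; exists t. Qed.

Lemma cone_drop A (t : 'I_N -> R) k0 : k0 \in A -> t k0 = 0 ->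
  (forall k, k \in A -> 0 <= t k) ->
  cone Phi (A :\ k0) (\sum_(k in A) t k *: tnth Phi k).
Proof.
move=> k0A tk0 t0; rewrite (big_setD1 k0)//= tk0 scale0r add0r.
by apply: cone_restrict => k /setD1P[_]; exact: t0.
Qed.

Lemma cone_sub A A' x : A \subset A' -> cone Phi A x -> cone Phi A' x.
Proof.
move=> AA' /coneP[t t0 ->].
rewrite (_ : \sum_(k in A) _ = \sum_(k in A') (if k \in A then t k else 0) *: tnth Phi k).
  by apply: cone_restrict => k _; case: ifP.
rewrite [RHS](big_setID A)/= (finset.setIidPr AA') [X in _ + X]big1 ?addr0.
  by apply: eq_bigr => k ->.
by move=> k /setDP[_ /negPf ->]; rewrite scale0r.
Qed.

Lemma free_subfamily s :
  (forall a : 'I_N -> R, \sum_(k in s) a k *: tnth Phi k = 0 ->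
     forall k, k \in s -> a k = 0) ->
  free [seq tnth Phi k | k <- enum s].
Proof.
move=> indep; pose e := enum_tuple s; apply/(@freeP _ _ _ (map_tuple (tnth Phi) e)) => c c0 i.
have inje : injective (tnth e) by apply/tuple_uniqP; rewrite enum_uniq.
pose a k := \sum_i (tnth e i == k)%:R * c i.
have ae j : a (tnth e j) = c j.
  rewrite /a (bigD1 j)//= eqxx mul1r big1 ?addr0// => i' /negPf ij.
  by rewrite (inj_eq inje) ij mul0r.
rewrite -ae; apply: indep; last by rewrite -mem_enum; exact: (mem_tnth i e).
rewrite -[RHS]c0 -big_enum/= (big_tuple _ _ e xpredT); apply: eq_bigr => j _.
by rewrite ae -tnth_nth tnth_map.
Qed.

(** As long as the family is dependent, a multiple of a linear relation is subtracted so that all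
    coefficients stay non-negative and one becomes 0. *)
Lemma caratheodory A x : cone Phi A x ->
  exists s, [/\ s \subset A, free [seq tnth Phi k | k <- enum s] & cone Phi s x].
Proof.
elim: {A}#|A| {-2}A (leqnn #|A|) => [|m IH] A Am xA.
  move: Am; rewrite leqn0 cards_eq0 => /eqP A0.
  by exists A; split=> //; rewrite A0 enum_set0 nil_free.
have [fA|nfA] := boolP (free [seq tnth Phi k | k <- enum A]); first by exists A.
have [a [a0 [k1 k1A a1]]] : exists a : 'I_N -> R,
    \sum_(k in A) a k *: tnth Phi k = 0 /\ exists2 k, k \in A & 0 < a k.
  apply: contrapT => H; move/negP: nfA; apply; apply: free_subfamily => a a0 k kA.
  apply/eqP; rewrite eq_le !leNgt; apply/andP; split; apply/negP => ak; apply: H.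
    by exists a; split=> //; exists k.
  exists (fun k => - a k); split; last by exists k; rewrite ?oppr_gt0.
  by under eq_bigr do rewrite scaleNr; rewrite sumrN a0 oppr0.
have [t t0 xt] := coneP xA.
have Pk1 : (k1 \in A) && (0 < a k1) by rewrite k1A.
(* The smallest ratio [t k / a k] over positive [a k] is the largest admissible multiple; the index
   [k0] attaining it is dropped. *)
case: (@Order.TotalTheory.arg_minP _ _ _ k1 (fun k => (k \in A) && (0 < a k))
  (fun k => t k / a k) Pk1) => k0 /andP[k0A ak0] k0min.
pose t' k := t k - t k0 / a k0 * a k.
have xA0 : cone Phi (A :\ k0) x.
  rewrite (_ : x = \sum_(k in A) t' k *: tnth Phi k); last first.
    under eq_bigr do rewrite /t' scalerBl -scalerA.
    by rewrite sumrB -scaler_sumr a0 scaler0 subr0.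
  apply: cone_drop => //; first by rewrite /t' divfK ?subrr// gt_eqF.
  move=> k kA; rewrite subr_ge0; have [ak|ak] := ltP 0 (a k).
    by rewrite -ler_pdivlMr// k0min// kA.
  by apply: le_trans (t0 k); rewrite mulr_ge0_le0// divr_ge0 ?t0// ltW.
have [|s [sA fs xs]] := IH (A :\ k0) _ xA0.
  by move: Am; rewrite (cardsD1 k0) k0A.
by exists s; split=> //; exact: fintype.subset_trans sA (finset.subsetDl _ _).
Qed.

(** A free family with fewer than [n] members would put [x] in one of the removed cones. *)
Lemma regular_cone_basis A x : regular_set Phi x -> cone Phi A x ->
  exists s, [/\ s \subset A, bases Phi s & cone Phi s x].
Proof.
move=> xreg /caratheodory[s [sA fs xs]]; exists s; split=> //; split=> //.
apply/eqP; rewrite eqn_leq; apply/andP; split.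
  have := fs; rewrite /free size_map -cardE => /eqP <-.
  by apply: leq_trans (dimvS (subvf _)) _; rewrite dimvf /dim/= mul1n.
by rewrite leqNgt; apply/negP => sn; apply: xreg; exists s.
Qed.

Variables (s : {set 'I_N}) (q : 'I_N -> 'cV[R]_n).
Hypothesis dualq : dual_system Phi s q.

Lemma dual_coneP x : cone Phi s x <-> forall k, k \in s -> 0 <= pairing x (q k).
Proof.
split=> [/coneP[t t0 ->] k ks|x0]; first by rewrite (pairing_dual dualq).
by rewrite (dualq.2 x); apply: cone_restrict.
Qed.

(** A zero coordinate would put [x] in the cone of [n - 1] members of [s]. *)
Lemma regular_cone_pos x : #|s| = n -> regular_set Phi x -> cone Phi s x ->
  forall k, k \in s -> 0 < pairing x (q k).
Proof.
move=> sn xreg /dual_coneP x0 k ks; rewrite lt_neqAle x0// andbT eq_sym.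
apply/eqP => xk0; apply: xreg; exists (s :\ k).
  by rewrite /= -sn [leqRHS](cardsD1 k) ks.
by rewrite (dualq.2 x); apply: cone_drop.
Qed.

End Cones.

Section Chambers.
Variables (R : realType) (n N : nat) (Phi : N.-tuple 'rV[R]_n).

Lemma big_chamber_regular c x : big_chamber Phi c -> c x -> regular_set Phi x.
Proof. by move=> [x0 _ ->]; exact: connected_component_sub. Qed.

(** The cone is closed, and on regular points it is cut out by strict inequalities, so its trace on
    the connected set [c] is open and closed in [c]. *)
Lemma big_chamber_cone c x s : big_chamber Phi c -> c x -> bases Phi s ->
  cone Phi s x -> c `<=` cone Phi s.
Proof.
move=> chc cx bs xs; have [q dualq] := bases_dual_system bs.
have cc : connected c by case: chc => x0 _ ->; exact: component_connected.
suff <- : c `&` cone Phi s = c by apply: subIsetr.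
apply: cc; first by exists x.
- exists (\bigcap_(k in [set` enum s]) [set v | 0 < pairing v (q k)]).
    rewrite bigcap_seq; elim/big_rec: _ => [|k U _ oU]; first exact: openT.
    apply: openI => //; apply: (@open_comp _ _ _ [set a : R | 0 < a]); last exact: open_gt.
    by move=> l _; exact: pairing_continuous.
  apply/seteqP; split=> v [cv vs]; split=> //.
    move=> k /=; rewrite mem_enum => ks; apply: (regular_cone_pos dualq bs.1 _ vs) => //.
    exact: big_chamber_regular cv.
  by apply/(dual_coneP dualq) => j js; apply/ltW/vs; rewrite /= mem_enum.
- exists (cone Phi s) => //.
  rewrite (_ : cone Phi s = \bigcap_(k in [set` s]) [set v | 0 <= pairing v (q k)]).
    apply: closed_bigI => k _; apply: (@closed_comp _ _ _ [set a : R | 0 <= a]).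
      by move=> l _; exact: pairing_continuous.
    exact: closed_ge.
  by apply/seteqP; split=> v /(dual_coneP dualq).
Qed.

(** Replaces the chamber by one of its points, which still makes sense for subfamilies. *)
Lemma chamber_basesE c x : big_chamber Phi c -> c x ->
  chamber_bases Phi c = [set s | bases Phi s /\ cone Phi s x].
Proof.
move=> chc cx; apply/seteqP; split=> s [bs cs]; split=> //; first exact: cs.
exact: big_chamber_cone cx bs cs.
Qed.

End Chambers.

(** * Transport along the difference equations *)

Section Torsion.
Variables (R : realType) (n N : nat) (Gamma : set 'cV[R]_n).
Hypothesis lattice : is_full_lattice Gamma.
Variables (Phi : N.-tuple 'rV[R]_n) (s : {set 'I_N}).
Hypothesis Phi_dual : forall k : 'I_N, dual_lattice Gamma (tnth Phi k).
Variable q : 'I_N -> 'cV[R]_n.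
Hypothesis dualq : dual_system Phi s q.
Variables (y : 'rV[R[i]]_N) (T : set 'cV[R[i]]_n).
Hypothesis repsT : is_representatives Gamma (Gset Phi y s) T.

(** The multiples of [l], reduced modulo [int_span], lie in the finite set of fundamental points, so
    two of them agree. *)
Lemma dual_lattice_torsion l : dual_lattice Gamma l ->
  exists2 m, (0 < m)%N & int_span Phi s (l *+ m).
Proof.
move=> Ll; pose f m := l *+ m - lattice_floor Phi s q (l *+ m).
have Lm m : dual_lattice Gamma (l *+ m).
  by move=> v Gv; rewrite -scaler_nat pairingZl rpredM ?natr_int// Ll.
have fA m : fundamental_points Gamma s q (f m).
  split; last exact: sub_lattice_floor.
  by apply: dual_latticeB => //; apply: (int_span_dual Phi_dual); exact: lattice_floor_int.
have [i [j [ij fij]]] : exists i j, (i < j)%N /\ f i = f j.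
  apply: contrapT => H; apply: infinite_nat.
  have injf : {in setT &, injective f}.
    move=> i j _ _ fij; case: (ltngtP i j) => // ij.
      by exfalso; apply: H; exists i, j.
    by exfalso; apply: H; exists j, i.
  rewrite -(eq_finite_set (inj_card_eq injf)).
  apply: sub_finite_set (fundamental_points_finite lattice dualq).
  by move=> _ [m _ <-].
exists (j - i)%N; first by rewrite subn_gt0.
rewrite mulrnBr; last exact: ltnW.
rewrite (subr_exchange (esym fij)); apply: (int_spanB dualq); exact: lattice_floor_int.
Qed.

Lemma sum_reps_neq0 : \sum_(p \in T) (1 : R[i]) != 0.
Proof.
have [p Gp] := Gset_nonempty dualq y; have [r [[Tr _] _]] := repsT.2 _ Gp.
have finT := reps_finite lattice Phi_dual dualq repsT.
rewrite fsbig_finite//= big_const_seq count_predT iter_addr_0 pnatr_eq0 -lt0n -has_predT.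
by apply/hasP; exists r => //; rewrite in_fset_set// inE.
Qed.

(* Otherwise the w_p are m-th roots of unity different from 1, so each geometric
   sum vanishes, whereas summing first over p leaves only the number of p. *)
Lemma generic_no_relation k (m : nat) (a : 'I_N -> int) :
  (forall p, Gset Phi y s p ->
     cexp (y 0 k) * cexp (cpairing (tnth Phi k) p) != 1) ->
  (0 < m)%N -> tnth Phi k *+ m = \sum_(j in s) (a j)%:~R *: tnth Phi j ->
  (forall j, (0 < j < m)%N -> ~ int_span Phi s (tnth Phi k *+ j)) ->
  cexp (y 0 k) ^+ m != \prod_(j in s) cexp (y 0 j) ^ a j.
Proof.
move=> gen m0 ma mmin; apply/eqP => uk.
have finT := reps_finite lattice Phi_dual dualq repsT.
pose w p := cexp (- cpairing (tnth Phi k) p) / cexp (y 0 k).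
have uk0 := cexp_neq0 (y 0 k).
have cexpn j p : cexp (- cpairing (tnth Phi k) p) ^+ j = cexp (- cpairing (tnth Phi k *+ j) p).
  by rewrite -cexpMn -[tnth Phi k *+ j]scaler_nat cpairingZl rmorph_nat mulr_natl mulNrn.
have geo p : T p -> \sum_(j < m) w p ^+ j = 0.
  move=> Tp; have Gp := repsT.1 _ Tp.
  have : w p ^+ m - 1 = 0.
    rewrite expr_div_n cexpn ma (cexp_int_span _ Gp) -uk divff ?subrr//.
    by rewrite expf_neq0.
  rewrite subrX1 => /eqP; rewrite mulf_eq0 => /orP[|/eqP//].
  rewrite subr_eq0 => /eqP wp1; have /eqP[] := gen p Gp.
  move: wp1; rewrite /w cexpN -invfM => /(congr1 GRing.inv).
  by rewrite invrK invr1 mulrC.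
have := sum_reps_neq0; apply/negP/negPn/eqP.
transitivity (\sum_(p \in T) \sum_(j < m) w p ^+ j); last by apply: fsbig1.
rewrite (_ : \sum_(p \in T) _ = \sum_(j < m) \sum_(p \in T) w p ^+ j); last first.
  by rewrite fsbig_finite//= exchange_big/=; apply: eq_bigr => j _; rewrite fsbig_finite.
case: m m0 {ma uk geo} mmin => // m _ mmin.
rewrite big_ord_recl [X in _ = _ + X]big1 ?addr0.
  by apply: eq_fsbigr => p _; rewrite expr0.
move=> j _; under eq_fsbigr do rewrite expr_div_n cexpn.
rewrite -mulr_fsuml (reps_sum_notin lattice dualq repsT) ?mul0r//.
  move=> v Gv; rewrite -scaler_nat pairingZl rpredM ?natr_int//.
  exact: Phi_dual.
by apply: mmin; rewrite lift0 /= ltnS ltn_ord.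
Qed.

End Torsion.

(** Near [a], the point [b] lies strictly between [ceil a - 1] and [floor a + 1]. This means that a
    moving point only passes to a unit interval touching its present position. *)
Lemma floor_near (R : realType) (a : R) :
  \forall b \near a, (Num.floor b)%:~R <= a <= (Num.floor b)%:~R + 1.
Proof.
have /andP[c1 c2] := ceil_itv a; have /andP[f1 f2] := floor_itv a.
have : nbhs a [set` `](Num.ceil a - 1)%:~R, (Num.floor a + 1)%:~R[].
  by apply: near_in_itvoo; rewrite in_itv/= c1 f2.
apply: filterS => b; rewrite /= in_itv/= => /andP[b1 b2]; apply/andP; split.
  by apply: le_trans f1; rewrite ler_int -ltzD1 floor_lt_int.
apply: le_trans c2 _; rewrite -[_ + 1](intrD _ _ 1) ler_int -lerBlDr floor_ge_int.
exact: ltW.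
Qed.

Section Transport.
Variables (R : realType) (n N : nat) (Phi : N.-tuple 'rV[R]_n) (A : {set 'I_N}).
Variables (K : fieldType) (u : 'I_N -> K) (D : 'rV[R]_n -> K) (x l0 : 'rV[R]_n).
Hypothesis u0 : forall j, u j != 0.

Local Notation shift z := (\sum_(k in A) (z k)%:~R *: tnth Phi k).

Hypothesis transport : forall (z : 'I_N -> int) j, j \in A ->
  zonotope Phi (A :\ j) (x - (l0 + shift z)) ->
  D (l0 + shift z) = u j * D (l0 + shift z - tnth Phi j).

(** [D] at the lattice point attached to the cube [z], normalized so that the difference equation
    becomes equality across a common face. *)
Let H (z : 'I_N -> int) := (\prod_(k in A) u k ^ (- z k)) * D (l0 + shift z).
Let in_cube (t : 'I_N -> R) (z : 'I_N -> int) :=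
  forall k, k \in A -> (z k)%:~R <= t k <= (z k)%:~R + 1.

(** As [t] is on the lower [j]-face of the cube [z], the [j]-th coefficient of [t - z] is 0, which
    is what [transport] requires. *)
Let H_step t z j : \sum_(k in A) t k *: tnth Phi k = x - l0 -> j \in A ->
  in_cube t z -> t j = (z j)%:~R ->
  H z = H (fun k => if k == j then z k - 1 else z k).
Proof.
move=> tx jA tz tj; rewrite /H (transport jA); last first.
  exists (fun k => if k \in A then t k - (z k)%:~R else 0) => [k|].
    by case: ifP => [/tz|_]; [lra|rewrite lexx ler01].
  rewrite opprD addrA -tx -sumrB [RHS](big_setD1 j)//= tj subrr add0r.
  by apply: eq_bigr => k /setD1P[_ ->]; rewrite scalerBl.
set z' := fun k => if k == j then z k - 1 else z k.
have z'j : z' j = z j - 1 by rewrite /z' eqxx.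
have z'k k : k \in A :\ j -> z' k = z k by move=> /setD1P[/negPf kj _]; rewrite /z' kj.
have -> : \prod_(k in A) u k ^ (- z' k) = u j * \prod_(k in A) u k ^ (- z k).
  rewrite (big_setD1 j)//= [in RHS](big_setD1 j)//= z'j opprB addrC expfzDr// expr1z.
  rewrite [u j ^ _ * _]mulrC -mulrA; congr (_ * (_ * _)).
  by apply: eq_bigr => k /z'k ->.
have -> : shift z' = shift z - tnth Phi j.
  rewrite (big_setD1 j)//= [in RHS](big_setD1 j)//= z'j intrB scalerBl scale1r addrAC.
  by congr (_ + _ - _); apply: eq_bigr => k /z'k ->.
by rewrite addrA mulrCA mulrA.
Qed.

(** Two closed cubes containing [t] differ by at most 1 in each coordinate, and one coordinate is
    changed at a time. *)
Let H_cube t z z' : \sum_(k in A) t k *: tnth Phi k = x - l0 ->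
  in_cube t z -> in_cube t z' -> H z = H z'.
Proof.
move=> tx; elim: {z}#|[set k in A | z k != z' k]| {-2}z (leqnn #|[set k in A | z k != z' k]|).
  move=> z; rewrite leqn0 cards_eq0 => /eqP zz' _ _.
  have {}zz' k : k \in A -> z k = z' k.
    move=> kA; apply/eqP/negPn/negP => zk.
    by have := finset.in_set0 k; rewrite -zz' inE kA zk.
  rewrite /H; congr (_ * D (_ + _)); apply: eq_bigr => k kA; by rewrite zz'.
move=> m IH z zm tz tz'.
have [zz'|] := eqVneq [set k in A | z k != z' k]%SET finset.set0.
  by apply: IH => //; rewrite zz' cards0.
case/set0Pn => j; rewrite inE => /andP[jA zj].
pose z1 k := if k == j then z' k else z k.
have tz1 : in_cube t z1 by move=> k kA; rewrite /z1; case: eqP => _; [exact: tz'|exact: tz].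
transitivity (H z1); last first.
  apply: IH => //; rewrite -ltnS; apply: leq_trans zm.
  rewrite [X in (_ < X)%N](cardsD1 j) inE jA zj/= add1n ltnS; apply: subset_leq_card.
  apply/fintype.subsetP => k; rewrite !inE /z1; case: (eqVneq k j) => [->|_].
    by rewrite eqxx andbF.
  by [].
have Hext z2 z3 : z2 =1 z3 -> H z2 = H z3.
  by move=> e; rewrite /H; congr (_ * D (_ + _)); apply: eq_bigr => k _; rewrite e.
have := tz j jA; have := tz' j jA => /andP[a1 a2] /andP[b1 b2].
have : (z j < z' j)%R || (z' j < z j)%R by rewrite -neq_lt.
(* The larger of the two integers equals [t j], so [H_step] is applied to the cube with that
   coordinate. *)
case/orP => zlt.
  have e : z' j = z j + 1.
    have : (z' j)%:~R <= (z j + 1)%:~R :> R by rewrite intrD; lra.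
    by rewrite ler_int; lia.
  rewrite [RHS](H_step tx jA tz1); last first.
    by rewrite /z1 eqxx e intrD; rewrite e intrD in a1; lra.
  by apply: Hext => k; rewrite /z1; case: eqP => // ->; rewrite e addrK.
have e : z j = z' j + 1.
  have : (z j)%:~R <= (z' j + 1)%:~R :> R by rewrite intrD; lra.
  by rewrite ler_int; lia.
rewrite (H_step tx jA tz); last by rewrite e intrD; rewrite e intrD in b1; lra.
by apply: Hext => k; rewrite /z1; case: eqP => // ->; rewrite e addrK.
Qed.

Hypothesis l0_box : zonotope Phi A (x - l0).

(** Along [t + r m] the represented point is fixed, and [H] of the current cube is locally constant
    in [r], hence constant. At [r = 0] the cube 0 gives [D l0]; at [r = 1] the cube [m] gives the
    right-hand side. *)
Lemma transport_relation (m : 'I_N -> int) : shift m = 0 ->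
  D l0 = (\prod_(k in A) u k ^ (- m k)) * D l0.
Proof.
move=> m0; have [t t01 tx] := l0_box.
pose tm (r : R) k := t k + r * (m k)%:~R.
have tmx r : \sum_(k in A) tm r k *: tnth Phi k = x - l0.
  rewrite -tx; under eq_bigr do rewrite scalerDl -scalerA.
  by rewrite big_split/= -scaler_sumr m0 scaler0 addr0.
pose z r k := Num.floor (tm r k).
have tmz r : in_cube (tm r) (z r).
  by move=> k _; have := floor_itv (tm r k); rewrite intrD /z; lra.
have cst : [set r | H (z r) = H (z 0)] = setT.
  have near_eq r : \forall r' \near r, H (z r') = H (z r).
    have : \forall r' \near r, forall k, (z r' k)%:~R <= tm r k <= (z r' k)%:~R + 1.
      apply: (@filter_forall _ _
        (fun k r' => (z r' k)%:~R <= tm r k <= (z r' k)%:~R + 1) (nbhs r)) => k.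
      have tmc : tm r' k @[r' --> r] --> tm r k.
        rewrite /tm; apply: cvgD; first exact: cvg_cst.
        by apply: cvgM; [exact: cvg_id | exact: cvg_cst].
      exact: tmc (floor_near (tm r k)).
    by apply: filterS => r' zr'; apply: (H_cube (tmx r)) => // k _; exact: zr'.
  have level_open : forall w : K, open [set r | H (z r) = w].
    move=> w; rewrite openE => r /= wr; rewrite /interior/=.
    by move: (near_eq r); apply: filterS => r' /= ->.
  have cT : connected [set: R] by apply/connected_intervalP.
  apply: (cT [set r | H (z r) = H (z 0)]); first by exists 0.
    by exists [set r | H (z r) = H (z 0)]; rewrite ?setTI.
  exists [set r | H (z r) = H (z 0)]; rewrite ?setTI//.
  (* The complement is the union of the other level sets, all open. *)
  rewrite -[X in closed X]setCK closedC.
  rewrite (_ : ~` _ = \bigcup_(w in [set w | w != H (z 0)]) [set r | H (z r) = w]).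
    by apply: bigcup_open.
  apply/seteqP; split=> [r /= /eqP rw|r [w /= /eqP ww] rw]; last by rewrite rw.
  by exists (H (z r)).
have H1 : H (z 1) = H (z 0) by have : [set: R] 1 by []; rewrite -cst.
have <- : H (fun=> 0) = D l0.
  rewrite /H big1 ?mul1r//.
  by rewrite big1 ?addr0// => k _; rewrite scale0r.
rewrite {1}(@H_cube (tm 0) _ (z 0)) ?tmx//; last first.
  by move=> k kA; rewrite /tm mul0r addr0 add0r; exact: t01.
rewrite -H1 (@H_cube (tm 1) _ m) ?tmx//; last first.
  by move=> k kA; rewrite /tm mul1r; have := t01 k; lra.
rewrite /H m0 addr0; congr (_ * _).
rewrite [in RHS]big1 ?mul1r//.
by rewrite big1 ?addr0// => k _; rewrite scale0r.
Qed.

End Transport.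

(** * The recursion and the main induction *)

Section PartitionFunction.
Variables (R : realType) (n N : nat) (Phi : N.-tuple 'rV[R]_n) (y : 'rV[R[i]]_N).
Hypothesis Phi_halfspace : in_open_halfspace Phi.
Implicit Types (A : {set 'I_N}) (l : 'rV[R]_n).

Definition partition_points A l : set 'rV[R]_N :=
  [set xi | [/\ forall k, 0 <= xi 0 k, forall k, xi 0 k \is a Num.int,
     forall k, k \notin A -> xi 0 k = 0 & \sum_(k < N) xi 0 k *: tnth Phi k = l]].

Definition weight (xi : 'rV[R]_N) : R[i] :=
  cexp (\sum_(k < N) y 0 k * (xi 0 k)%:C%C).

Definition partition_sum_on A l : R[i] := \sum_(xi \in partition_points A l) weight xi.

Lemma partition_sum_setT l : partition_sum Phi y l = partition_sum_on [set: 'I_N]%SET l.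
Proof.
apply: eq_fsbigl; apply/seteqP; split=> xi; last by case=> ? ? _ ?.
by case=> [[? ?] ?]; split=> // k; rewrite inE.
Qed.

(** Pairing with a vector [v] positive on all of [Phi] bounds each coordinate of a solution. *)
Lemma partition_points_finite A l : finite_set (partition_points A l).
Proof.
have [v Phiv] := Phi_halfspace.
apply: (@finite_int_valued R _ 'I_N _ (fun (xi : 'rV[R]_N) k => xi 0 k)
  (\sum_k `|pairing l v / pairing (tnth Phi k) v|)) => [xi k []//|xi k [xi0 _ _ xil]|xi xi' _ _ e].
- apply: (@le_trans _ _ `|pairing l v / pairing (tnth Phi k) v|); last first.
    by rewrite [leRHS](bigD1 k)//= lerDl sumr_ge0.
  rewrite ger0_norm//; apply: le_trans (ler_norm _).
  rewrite ler_pdivlMr// -xil pairing_suml (bigD1 k)//= pairingZl lerDl sumr_ge0// => j _.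
  by rewrite pairingZl mulr_ge0// ltW.
- by apply/rowP => k; exact: e.
Qed.

Lemma partition_points_cone A l xi : partition_points A l xi -> cone Phi A l.
Proof.
move=> [xi0 _ xiA <-]; rewrite (bigID (mem A))/= [X in _ + X]big1 ?addr0.
  by apply: cone_restrict.
by move=> k kA; rewrite xiA// scale0r.
Qed.

(** Solutions with [xi 0 j = 0] are those of [A :\ j]; the others have [xi 0 j] at least 1 and come
    from solutions for [l - tnth Phi j] by adding 1 to that coordinate. *)
Lemma partition_sum_on_rec A j l : j \in A ->
  partition_sum_on A l = partition_sum_on (A :\ j) l
    + cexp (y 0 j) * partition_sum_on A (l - tnth Phi j).
Proof.
move=> jA; rewrite /partition_sum_on; pose e : 'rV[R]_N := delta_mx 0 j.
have eE k : e 0 k = (k == j)%:R by rewrite mxE.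
have sume : \sum_(k < N) e 0 k *: tnth Phi k = tnth Phi j.
  rewrite (bigD1 j)//= eE eqxx scale1r big1 ?addr0// => k /negPf kj.
  by rewrite eE kj scale0r.
have sumDe (xi : 'rV[R]_N) : \sum_(k < N) (xi + e) 0 k *: tnth Phi k
    = \sum_(k < N) xi 0 k *: tnth Phi k + tnth Phi j.
  by rewrite -sume -big_split; apply: eq_bigr => k _; rewrite mxE scalerDl.
have -> : partition_points A l = partition_points (A :\ j) l
    `|` [set xi + e | xi in partition_points A (l - tnth Phi j)].
  apply/seteqP; split=> [xi [xi0 xiint xiA xil]|
    xi [[xi0 xiint xiA xil]|[xi' [xi0 xiint xiA xil] <-]]].
  - have [xij|xij] := eqVneq (xi 0 j) 0; [left|right].
      split=> // k; rewrite !inE negb_and negbK => /orP[/eqP ->//|]; exact: xiA.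
    have xij1 : 1 <= xi 0 j.
      have /intrP[m em] := xiint j; rewrite em (ler_int _ 1) -gtz0_ge1.
      by rewrite -(ltr_int R) -em lt_neqAle eq_sym xij xi0.
    exists (xi - e); last by rewrite subrK.
    split=> [k|k|k kA|].
    + by rewrite !mxE eqxx/=; case: eqP => [->|_]; rewrite ?subr_ge0 ?subr0.
    + by rewrite mxE [X in _ + X]mxE eE rpredB ?natr_int// xiint.
    + rewrite mxE [X in _ + X]mxE eE xiA// (_ : (k == j) = false) ?subrr//.
      by apply: contraNF kA => /eqP ->.
    + by have := sumDe (xi - e); rewrite subrK xil => ->; rewrite addrK.
  - split=> // k kA; apply: xiA; by rewrite !inE negb_and kA orbT.
  - split=> [k|k|k kA|].
    + by rewrite mxE eE addr_ge0// ler0n.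
    + by rewrite mxE eE rpredD ?natr_int// xiint.
    + rewrite mxE eE xiA// (_ : (k == j) = false) ?addr0//.
      by apply: contraNF kA => /eqP ->.
    + by rewrite sumDe xil subrK.
rewrite fsbigU0; first last.
- move=> xi [[_ _ xiA _] [xi' [xi0 _ _ _] exi]].
  have := xiA j; rewrite !inE eqxx/= -exi mxE eE eqxx => /(_ isT) xij.
  by move/eqP: xij; rewrite paddr_eq0 ?xi0 ?ler01// oner_eq0 andbF.
- exact/finite_image/partition_points_finite.
- exact: partition_points_finite.
congr (_ + _); rewrite fsbig_image; last by move=> xi xi' _ _ /addIr.
rewrite mulr_fsumr; apply: eq_fsbigr => xi _; rewrite /weight -cexpD; congr cexp.
rewrite (eq_bigr (fun k => y 0 k * (xi 0 k)%:C%C + y 0 k * (e 0 k)%:C%C)).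
  rewrite big_split/= addrC; congr (_ + _).
  rewrite (bigD1 j)//= eE eqxx rmorph1 mulr1 big1 ?addr0// => k /negPf kj.
  by rewrite eE kj rmorph0 mulr0.
by move=> k _; rewrite mxE rmorphD mulrDr.
Qed.

End PartitionFunction.

Section ChamberSum.
Variables (R : realType) (n N : nat) (Gamma : set 'cV[R]_n).
Hypothesis lattice : is_full_lattice Gamma.
Variable Phi : N.-tuple 'rV[R]_n.
Hypothesis Phi_dual : forall k : 'I_N, dual_lattice Gamma (tnth Phi k).
Variable vol : {measure set (borel_dual R n) -> \bar R}.
Hypothesis vol_normalized : is_lattice_volume (dual_lattice Gamma) vol.
Variable y : 'rV[R[i]]_N.
Hypothesis y_generic : generic Phi y.
Variable RG : {set 'I_N} -> set 'cV[R[i]]_n.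
Hypothesis RG_reps : forall s, bases Phi s ->
  is_representatives Gamma (Gset Phi y s) (RG s).
Variable x : 'rV[R]_n.
Implicit Types (A s : {set 'I_N}) (l : 'rV[R]_n).
Local Notation L := (dual_lattice Gamma).

Definition basis_term A s l : R[i] :=
  ((fine (vol (zonotope Phi s)))%:C%C)^-1 *
    \sum_(p \in RG s) cexp (- cpairing l p) *
      \prod_(k in A :\: s) (1 - cexp (y 0 k) * cexp (cpairing (tnth Phi k) p))^-1.

Definition chamber_sum A l : R[i] :=
  \sum_(s : {set 'I_N} | (s \subset A) && `[< bases Phi s /\ cone Phi s x >])
    basis_term A s l.

(** At points of [Gset] the factor [cexp (y 0 j)] cancels the one created by the shift of [l]. *)
Lemma basis_term_in A s j l : bases Phi s -> j \in s ->
  basis_term A s l = cexp (y 0 j) * basis_term A s (l - tnth Phi j).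
Proof.
move=> bs js; rewrite /basis_term [RHS]mulrCA; congr (_ * _); rewrite mulr_fsumr.
apply: eq_fsbigr => p /set_mem Tp; rewrite mulrA; congr (_ * _).
rewrite cpairingDl cpairingNl opprD opprK cexpD mulrCA.
by rewrite ((RG_reps bs).1 _ Tp j js) -cexpD subrr cexp0 mulr1.
Qed.

(** Termwise this is 1 / (1 - w) = 1 + w / (1 - w) with w = e^(y_j) e^(<beta_j, p>), which is not 1
    by genericity. *)
Lemma basis_term_notin A s j l : bases Phi s -> j \in A -> j \notin s ->
  basis_term A s l = basis_term (A :\ j) s l
    + cexp (y 0 j) * basis_term A s (l - tnth Phi j).
Proof.
move=> bs jA js; have [q dualq] := bases_dual_system bs.
have finT := reps_finite lattice Phi_dual dualq (RG_reps bs).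
rewrite /basis_term [X in _ + X]mulrCA -mulrDr; congr (_ * _).
rewrite mulr_fsumr -fsbig_split//; apply: eq_fsbigr => p /set_mem Tp.
have Asj : j \in A :\: s by rewrite inE js.
have -> : A :\ j :\: s = (A :\: s) :\ j.
  by apply/setP => k; rewrite !inE andbCA.
rewrite cpairingDl cpairingNl opprD opprK cexpD !(big_setD1 j Asj)/=.
have := y_generic bs ((RG_reps bs).1 _ Tp) js.
move: (\prod_(_ in _) _) (cexp (- _)) (cexp (y 0 j)) (cexp (cpairing _ p)) => P a b d.
rewrite -subr_eq0 -oppr_eq0 opprB => bd.
have {bd} := mulVf bd; move: (1 - b * d)^-1 => e ebd.
by rewrite -[a * P]mulr1 -ebd; ring.
Qed.

(** Bases avoiding [j] are those contained in [A :\ j] and give both terms; bases containing [j]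
    contribute only to the shifted one. *)
Lemma chamber_sum_rec A j l : j \in A ->
  chamber_sum A l = chamber_sum (A :\ j) l
    + cexp (y 0 j) * chamber_sum A (l - tnth Phi j).
Proof.
move=> jA; rewrite /chamber_sum mulr_sumr.
rewrite (bigID (fun s : {set 'I_N} => j \in s))/= [X in _ + X = _](eq_bigr (fun s =>
   basis_term (A :\ j) s l + cexp (y 0 j) * basis_term A s (l - tnth Phi j))); last first.
  by move=> s /andP[/andP[_ /asboolP[bs _]] js]; exact: basis_term_notin.
rewrite big_split/= addrCA; congr (_ + _).
  by apply: eq_bigl => s; rewrite finset.subsetD1 andbAC.
rewrite [RHS](bigID (fun s : {set 'I_N} => j \in s))/=; congr (_ + _).
by apply: eq_bigr => s /andP[/andP[_ /asboolP[bs _]] js]; exact: basis_term_in.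
Qed.

Lemma Efun_chamber_sum c l : big_chamber Phi c -> c x ->
  Efun Phi vol y RG c l = chamber_sum [set: 'I_N]%SET l.
Proof.
move=> chc cx; rewrite /Efun (chamber_basesE chc cx) /chamber_sum.
pose P s := `[< bases Phi s /\ cone Phi s x >].
rewrite (_ : [set s | _] = [set` P]); last first.
  by apply/seteqP; split=> s Ps; [exact: asboolT Ps | exact: asboolW Ps].
rewrite -(@bigfs _ _ _ _ (index_enum {set 'I_N}) P)//; first last.
- by move=> s _; rewrite mem_index_enum.
- exact: index_enum_uniq.
apply: eq_big => [s|s _]; first by rewrite finset.subsetT.
rewrite /basis_term; congr (_ * _); apply: eq_fsbigr => p _; congr (_ * _).
by apply: eq_bigl => k; rewrite !inE andbT.
Qed.

Hypothesis x_regular : regular_set Phi x.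

(** The only basis inside [s] is [s]. If [l] is not in [int_span], both sides are 0; otherwise the
    integral coordinates of [l] form the unique solution, and all representatives give the same
    term. *)
Lemma partition_sum_on_basis s l : bases Phi s -> cone Phi s x ->
  in_open_halfspace Phi -> L l -> zonotope Phi s (x - l) ->
  partition_sum_on Phi y s l = chamber_sum s l.
Proof.
move=> bs xs halfspace Ll; have [q dualq] := bases_dual_system bs.
have repsT := RG_reps bs.
move=> /(zonotopeP dualq) xl; have xpos := regular_cone_pos dualq bs.1 x_regular xs.
have -> : chamber_sum s l = basis_term s s l.
  rewrite /chamber_sum (bigD1 s)/=; last by rewrite fintype.subxx; apply/asboolP.
  rewrite big1 ?addr0// => s' /andP[/andP[s's /asboolP[bs' _]]] /eqP[].
  by apply/eqP; rewrite eqEcard s's (bs.1 : #|s| = n) (bs'.1 : #|s'| = n) leqnn.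
have -> : basis_term s s l = (\sum_(p \in RG s) (1 : R[i]))^-1 *
    \sum_(p \in RG s) cexp (- cpairing l p).
  rewrite /basis_term (vol_zonotope_reps lattice vol_normalized Phi_dual dualq repsT).
  by congr (_ * _); apply: eq_fsbigr => p _; rewrite finset.setDv big_set0 mulr1.
have [|lNint] := pselect (int_span Phi s l); last first.
  rewrite (reps_sum_notin lattice dualq repsT)// mulr0.
  rewrite /partition_sum_on (_ : partition_points _ _ _ = set0) ?fsbig_set0//.
  apply/seteqP; split=> // xi [_ xiint xis xil]; apply: lNint.
  rewrite -xil (bigID (mem s))/= [X in _ + X]big1 ?addr0.
    exists (fun k => Num.floor (xi 0 k)) => //; apply: eq_bigr => k _.
    by rewrite floorK.
  by move=> k ks; rewrite xis// scale0r.
move=> [z _ zl].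
have -> : \sum_(p \in RG s) cexp (- cpairing l p)
    = (\prod_(k in s) cexp (y 0 k) ^ z k) * \sum_(p \in RG s) (1 : R[i]).
  rewrite mulr_fsumr; apply: eq_fsbigr => p /set_mem Tp.
  by rewrite -zl (cexp_int_span z (repsT.1 _ Tp)) mulr1.
rewrite mulrCA mulVf ?mulr1; last exact: (sum_reps_neq0 lattice Phi_dual dualq repsT).
(* The coordinate of [x] is positive and exceeds [z k] by at most 1, so the integer [z k] is greater
   than -1. *)
have z0 k : k \in s -> 0 <= z k.
  move=> ks; have := xl k ks; have := xpos k ks; rewrite pairingBl -zl.
  rewrite (pairing_dual dualq (fun j => (z j)%:~R))// => x0 /andP[_ xz].
  by rewrite -ltzD1 -(ltr_int R) intrD; lra.
pose xi : 'rV[R]_N := \row_k if k \in s then (z k)%:~R else 0.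
rewrite /partition_sum_on (_ : partition_points _ _ _ = [set xi]).
  rewrite fsbig_set1 /weight cexp_sum [LHS](bigID (mem s))/= [X in _ * X]big1 ?mulr1.
    apply: eq_bigr => k ks; rewrite mxE ks.
    case: (z k) (z0 k ks) => // m _; rewrite -pmulrn rmorph_nat mulr_natr cexpMn.
    by [].
  by move=> k /negPf ks; rewrite mxE ks rmorph0 mulr0 cexp0.
apply/seteqP; split=> [xi' [_ _ xi's xi'l]|_ ->].
  apply/rowP => k; rewrite mxE; case: ifPn => ks; last exact: xi's.
  rewrite -(pairing_dual dualq (fun j => xi' 0 j) ks).
  rewrite -(pairing_dual dualq (fun j => (z j)%:~R) ks) zl -xi'l; congr pairing.
  rewrite [RHS](bigID (mem s))/= [X in _ = _ + X]big1 ?addr0// => j js.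
  by rewrite xi's// scale0r.
split=> [k|k|k /negPf ks|].
- by rewrite mxE; case: ifP => // ks; rewrite ler0z z0.
- by rewrite mxE; case: ifP => // _; rewrite ?intr_int ?int_num0.
- by rewrite mxE ks.
- rewrite (bigID (mem s))/= [X in _ + X]big1 ?addr0.
    by rewrite -zl; apply: eq_bigr => k ks; rewrite mxE ks.
  by move=> k /negPf ks; rewrite mxE ks scale0r.
Qed.

(** A fixed regular [x] and arbitrary [A] let the induction remove indices, although a subfamily may
    fail to span and has larger chambers. *)
Lemma partition_sum_on_chamber A l : in_open_halfspace Phi -> L l ->
  zonotope Phi A (x - l) -> partition_sum_on Phi y A l = chamber_sum A l.
Proof.
move=> halfspace; have [m] := ubnP #|A|; elim: m => // m IH in A l *.
rewrite ltnS => Am Ll xl; have [xA|xNA] := pselect (cone Phi A x); last first.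
  rewrite /partition_sum_on (_ : partition_points _ _ _ = set0) ?fsbig_set0.
    rewrite /chamber_sum big1// => s /andP[sA /asboolP[_ xs]].
    by case: xNA; exact: cone_sub xs.
  (* A solution would put [l] in the cone of [A], hence also [x], which is [l] plus a point of the
     zonotope. *)
  apply/seteqP; split=> // xi /partition_points_cone /coneP[t t0 lt]; apply: xNA.
  have [t' t'01 xlt'] := xl; rewrite -[x](subrK l) addrC -xlt' lt -big_split/=.
  under eq_bigr do rewrite -scalerDl.
  by apply: cone_restrict => k _; have := t0 k; have := t'01 k; lra.
have [s [sA bs xs]] := regular_cone_basis x_regular xA.
have [eAs|] := eqVneq s A; first by rewrite -eAs in xl *; exact: partition_sum_on_basis.
rewrite finset.eqEsubset sA /= => /fintype.subsetPn[k kA ks].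
have [q dualq] := bases_dual_system bs.
pose D v := partition_sum_on Phi y A v - chamber_sum A v.
have L_shift (P : {set 'I_N}) (z : 'I_N -> int) : L (l + \sum_(j in P) (z j)%:~R *: tnth Phi j).
  rewrite -[X in L (_ + X)]opprK; apply: dual_latticeB => //; rewrite -sub0r.
  by apply: dual_latticeB; [exact: dual_lattice0 | exact: dual_lattice_sum].
have transport (z : 'I_N -> int) j : j \in A ->
    zonotope Phi (A :\ j) (x - (l + \sum_(i in A) (z i)%:~R *: tnth Phi i)) ->
    D (l + \sum_(i in A) (z i)%:~R *: tnth Phi i) = cexp (y 0 j) *
      D (l + \sum_(i in A) (z i)%:~R *: tnth Phi i - tnth Phi j).
  move=> jA; set v := l + _ => xv.
  rewrite /D (partition_sum_on_rec _ halfspace v jA) (chamber_sum_rec v jA).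
  (* The induction hypothesis for [A :\ j] cancels the unshifted terms of the two recursions. *)
  rewrite IH ?mulrBr; first by rewrite opprD addrACA subrr add0r.
  - by move: Am; rewrite (cardsD1 j) jA.
  - exact: L_shift.
  - exact: xv.
apply/eqP; rewrite -subr_eq0 -/(D l); apply/negPn/negP => Dl0.
have ex_m : exists m', (0 < m')%N && `[< int_span Phi s (tnth Phi k *+ m') >].
  have [m' m'0 km'] := dual_lattice_torsion lattice Phi_dual dualq (Phi_dual k).
  by exists m'; rewrite m'0; exact/asboolP.
case: (ex_minnP ex_m) => m1 /andP[m10 /asboolP[a _ ka]] m1min.
(* By genericity and the minimality of [m1] the two products differ; what then remains is to derive
   their equality from [D l != 0]. *)
have /eqP[] : cexp (y 0 k) ^+ m1 != \prod_(j in s) cexp (y 0 j) ^ a j.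
  apply: (generic_no_relation lattice Phi_dual dualq (RG_reps bs)) => //.
    by move=> p Gp; exact: y_generic bs _ Gp _ ks.
  move=> j /andP[j0 jm1] kj.
  by have := m1min j; rewrite j0 leqNgt jm1 => /(_ (asboolT kj)).
(* The relation for [tnth Phi k *+ m1], written as one integer vector on [A]. *)
pose r j := if j == k then m1%:Z else if j \in s then - a j else 0.
have rk : r k = m1%:Z by rewrite /r eqxx.
have rs j : j \in s -> r j = - a j.
  by move=> js; rewrite /r js; case: eqP => // jk; rewrite -jk js in ks.
(* Stated for any commutative monoid, to serve both the sum of vectors and the product of
   exponentials. *)
have big_r (W : Type) (idx : W) (op : Monoid.com_law idx) (F : 'I_N -> W) :
    (forall j, r j = 0 -> F j = idx) ->
    \big[op/idx]_(j in A) F j = op (F k) (\big[op/idx]_(j in s) F j).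
  move=> F0; rewrite (big_setD1 k)//=; congr (op _ _).
  rewrite (big_setID s)/= [X in op _ X]big1 ?Monoid.mulm1; last first.
    move=> j /setDP[/setD1P[/negPf jk _] /negPf js]; apply: F0.
    by rewrite /r jk js.
  apply: eq_bigl => j; rewrite !inE; have [js|] := boolP (j \in s); last by rewrite andbF.
  have -> : j != k by apply: contraNneq ks => <-.
  by rewrite (fintype.subsetP sA).
have r0 : \sum_(j in A) (r j)%:~R *: tnth Phi j = 0.
  rewrite big_r; last by move=> j ->; rewrite scale0r.
  rewrite rk -pmulrn scaler_nat -ka -big_split big1// => j js /=.
  by rewrite rs// intrN scaleNr subrr.
have := transport_relation (fun j => cexp_neq0 (y 0 j)) transport xl r0.
rewrite -[X in X = _ -> _]mul1r => /(mulIf Dl0)/esym.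
rewrite big_r; last by move=> j ->; rewrite oppr0 expr0z.
rewrite rk (eq_bigr (fun j => cexp (y 0 j) ^ a j)) => [|j js]; last by rewrite rs// opprK.
by rewrite -exprnN => /(canRL (mulVKf (expf_neq0 _ (cexp_neq0 _)))); rewrite mulr1.
Qed.

End ChamberSum.

Theorem theorem3p7 (R : realType) (n N : nat)
    (Gamma : set 'cV[R]_n) (Gamma_lattice : is_full_lattice Gamma)
    (Phi : N.-tuple 'rV[R]_n)
    (Phi_dual : forall k : 'I_N, dual_lattice Gamma (tnth Phi k))
    (Phi_spans : spans_dual Phi)
    (Phi_halfspace : in_open_halfspace Phi)
    (vol : {measure set (borel_dual R n) -> \bar R})
    (vol_normalized : is_lattice_volume (dual_lattice Gamma) vol)
    (c : set 'rV[R]_n) (c_chamber : big_chamber Phi c)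
    (y : 'rV[R[i]]_N) (y_generic : generic Phi y)
    (RG : {set 'I_N} -> set 'cV[R[i]]_n)
    (RG_reps : forall s, bases Phi s ->
       is_representatives Gamma (Gset Phi y s) (RG s))
    (l : 'rV[R]_n)
    (l_shifted : [set x - b | x in c & b in box Phi] l)
    (l_dual : dual_lattice Gamma l) :
  partition_sum Phi y l = Efun Phi vol y RG c l.
Proof.
(* The point [x] supplied by the membership of [l] is the regular point of the induction, and
   [x - l] is the point [b] of the box. *)
have [x cx [b boxb xbl]] := l_shifted.
rewrite partition_sum_setT (Efun_chamber_sum vol y RG l c_chamber cx).
apply: (partition_sum_on_chamber Gamma_lattice) => //.
  exact: big_chamber_regular c_chamber cx.
by rewrite -xbl subKr.
Qed.
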